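(* Let $M\ge2$ and $(a,b)\in\Delta$. Then (i) $\mu_{\alpha,a,b}={\rm Leb}$ (Lebesgue measure on $[0,1]^3$) if and only if $(a,b)=(\frac1{M+1},\frac1{M(M+1)})$; (ii) $\mu_{\beta,a,b}={\rm Leb}$ if and only if $(a,b)=(\frac1{M(M+1)},\frac1{M+1})$.
   Context: Fix an integer $M\ge2$. Maps. $\tau_a$ is given by - $\tau_a(x)=\frac{x-(k-1)a}{a}$ on $[(k-1)a,ka)$, $k=1,\dots,M$; - $\tau_a(x)=\frac{x-Ma}{1-Ma}$ on $[Ma,1]$. Let $D=\{\alpha_1,\dots,\alpha_M,\beta_1,\dots,\beta_M\}$. Put - $\Omega^+_{\alpha_k}=[(k-1)a,ka)\times[0,1]$; - $\Omega^+_{\beta_k}=[Ma,1]\times[\frac{k-1}M,\frac kM)$ for $k\le M-1$; - $\Omega^+_{\beta_M}=[Ma,1]\times[\frac{M-1}M,1]$. $f_a$ is given by - $f_a(x_u,x_c)=(\tau_a(x_u),\frac{x_c}M+\frac{k-1}M)$ on $\Omega^+_{\alpha_k}$; - $f_a(x_u,x_c)=(\tau_a(x_u),Mx_c-k+1)$ on $\Omega^+_{\beta_k}$. $\Delta=(0,\frac1M)^2$. For $(a,b)\in\Delta$, $\Omega_\gamma=\Omega^+_\gamma\times[0,1]$, and $f_{a,b}$ is given by - $f_{a,b}(x_u,x_c,x_s)=(f_a(x_u,x_c),(1-Mb)x_s)$ on $\Omega_{\alpha_k}$; - $f_{a,b}(x_u,x_c,x_s)=(f_a(x_u,x_c),bx_s+1+b(k-M-1))$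 on $\Omega_{\beta_k}$. Coding. $U=\bigcup_\gamma{\rm int}(\Omega_\gamma)$. $\Lambda_{a,b}$ is the set of points with a (unique) bi-infinite $f_{a,b}$-orbit $(x_n)_{n\in\mathbb Z}$, $x_0=x$, contained in $U$. $\pi_{a,b}:\Lambda_{a,b}\to D^{\mathbb Z}$ is given by $\pi_{a,b}(x)_n=\gamma$ iff $x_n\in{\rm int}(\Omega_\gamma)$. Dyck shift. $\Sigma_D=\{\omega\in D^{\mathbb Z}:\omega_j\cdots\omega_k\ne0$ for all $j<k\}$, where the product is in the monoid with zero generated by $D$ with relations $\alpha_i\beta_j=\delta_{ij}$. Height functions. With $s(\alpha_k)=1$, $s(\beta_k)=-1$, $H_0=0$ and $H_{i+1}(\omega)-H_i(\omega)=s(\omega_i)$. $B_\alpha$ is the set of $\omega\in\Sigma_D$ such that for each $i$, $\omega_i\in\{\alpha_k\}$ or ($\omega_i\in\{\beta_k\}$ and $\exists j\ge1$: $H_{i-j+1}(\omega)=H_{i+1}(\omega)$). $B_\beta$ is the set of $\omega\in\Sigma_D$ such that for each $i$, $\omega_i\in\{\beta_k\}$ or ($\omega_i\in\{\alpha_k\}$ and $\exists j\ge1$: $H_{i+j}(\omega)=H_i(\omega)$). The measures. $\Sigma_\alpha=\{\alpha_1,\dots,\alpha_M,\beta\}^{\mathbb Z}$ and $\Sigma_\beta=\{\alpha,\beta_1,\dots,\beta_M\}^{\mathbb Z}$. $\phi_\alpha:B_\alpha\to\Sigma_\alpha$ replaces each $\beta_k$ by $\beta$, and $\phi_\beta:B_\beta\to\Sigma_\beta$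 replaces each $\alpha_k$ by $\alpha$. $\lambda_\gamma$ is the uniform Bernoulli measure on $\Sigma_\gamma$. Define $\nu_\gamma(E)=\lambda_\gamma(\phi_\gamma(E\cap B_\gamma))$ and $\mu_{\gamma,a,b}(E)=\nu_\gamma(\pi_{a,b}(E\cap\Lambda_{a,b}))$ for $\gamma\in\{\alpha,\beta\}$. *)

(* Defs.v *)
From mathcomp Require Import all_boot all_order all_algebra.
From mathcomp Require Import all_classical all_reals all_analysis.
Set Implicit Arguments. Unset Strict Implicit. Unset Printing Implicit Defensive.
Import Order.TTheory GRing.Theory Num.Theory.
Import numFieldNormedType.Exports.
Local Open Scope ring_scope.
Local Open Scope classical_set_scope.

(* The alphabet D = {alpha_1..alpha_M, beta_1..beta_M}.
   Indices are 0-based: [Alpha i] with i : 'I_M is alpha_(i+1).        *)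
Inductive Dsym (M : nat) : Type :=
| Alpha of 'I_M
| Beta of 'I_M.

Notation pt R := ((R * R) * R)%type.

Section Maps.
Variable R : realType.
Variable M : nat.

(* points of [0,1]^3 written ((x_u, x_c), x_s) *)

Definition unit_cube : set (pt R) :=
  [set p | (0 <= p.1.1 <= 1) /\ (0 <= p.1.2 <= 1) /\ (0 <= p.2 <= 1)].

Definition OmegaP (a : R) (g : Dsym M) : set (R * R) :=
  match g with
  | Alpha i => [set q | (i%:R * a <= q.1 < (i.+1)%:R * a) /\ (0 <= q.2 <= 1)]
  | Beta i =>
      if (i.+1 < M)%N then
        [set q | (M%:R * a <= q.1 <= 1) /\
                 (i%:R / M%:R <= q.2 < (i.+1)%:R / M%:R)]
      else
        [set q | (M%:R * a <= q.1 <= 1) /\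
                 ((M.-1)%:R / M%:R <= q.2 <= 1)]
  end.

Definition Omega (a : R) (g : Dsym M) : set (pt R) :=
  [set p | OmegaP a g p.1 /\ 0 <= p.2 <= 1].

Definition tau (a : R) (x : R) (g : Dsym M) : R :=
  match g with
  | Alpha i => (x - i%:R * a) / a
  | Beta _ => (x - M%:R * a) / (1 - M%:R * a)
  end.

Definition fpiece (a b : R) (g : Dsym M) (p : pt R) : pt R :=
  match g with
  | Alpha i => ((tau a p.1.1 g, p.1.2 / M%:R + i%:R / M%:R),
                (1 - M%:R * b) * p.2)
  | Beta i => ((tau a p.1.1 g, M%:R * p.1.2 - i%:R),
               b * p.2 + 1 + b * ((i.+1)%:R - M%:R - 1))
  end.

Definition fab (a b : R) (p q : pt R) : Prop :=
  exists g : Dsym M, Omega a g p /\ q = fpiece a b g p.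

Definition U (a : R) : set (pt R) :=
  \bigcup_(g in [set: Dsym M]) interior (Omega a g : set (pt R)).

Definition orbitU (a b : R) (x : pt R) (o : int -> pt R) : Prop :=
  o 0 = x /\ (forall n : int, U a (o n) /\ fab a b (o n) (o (n + 1))).

Definition Lambda (a b : R) : set (pt R) :=
  [set x | exists o, orbitU a b x o].

Definition pi_image (a b : R) (E : set (pt R)) : set (int -> Dsym M) :=
  [set w | exists x, (E `&` Lambda a b) x /\
     exists o, orbitU a b x o /\
       forall n : int, interior (Omega a (w n) : set (pt R)) (o n)].

End Maps.

(* Dyck monoid with zero: the nonzero elements are the normal forms
   beta_{j1}...beta_{jr} alpha_{i1}...alpha_{is}; [None] is 0.
   State (bs, st): bs = the betas (left to right), st = the alphas,
   most recent first.  Right multiplication by a generator: *)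
Section Dyck.
Variable M : nat.

Definition dyck_step (s : option (seq 'I_M * seq 'I_M)) (d : Dsym M) :
    option (seq 'I_M * seq 'I_M) :=
  match s with
  | None => None
  | Some (bs, st) =>
      match d with
      | Alpha i => Some (bs, i :: st)
      | Beta j =>
          match st with
          | [::] => Some (rcons bs j, [::])
          | i :: st' => if i == j then Some (bs, st') else None
          end
      end
  end.

Definition dyck_prod (w : seq (Dsym M)) := foldl dyck_step (Some ([::], [::])) w.

Definition window (om : int -> Dsym M) (j k : int) : seq (Dsym M) :=
  [seq om (j + n%:Z)%R | n <- iota 0 `|k - j|.+1].

Definition Sigma_D : set (int -> Dsym M) :=
  [set om | forall j k : int, (j < k)%R -> dyck_prod (window om j k) <> None].

Definition sgn (d : Dsym M) : int :=
  match d with Alpha _ => 1 | Beta _ => -1 end%R.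

Definition isAlpha (d : Dsym M) := if d is Alpha _ then true else false.

(* H_0 = 0, H_{i+1} - H_i = s(omega_i) *)
Definition H (om : int -> Dsym M) (i : int) : int :=
  if (0 <= i)%R then (\sum_(0 <= k < `|i|) sgn (om k%:Z))%R
  else (- \sum_(0 <= k < `|i|) sgn (om (i + k%:Z)))%R.

Definition B_alpha : set (int -> Dsym M) :=
  [set om | Sigma_D om /\ forall i : int,
     isAlpha (om i) \/
     (~~ isAlpha (om i) /\ exists j : int, (1 <= j)%R /\
                          H om (i - j + 1) = H om (i + 1))].

Definition B_beta : set (int -> Dsym M) :=
  [set om | Sigma_D om /\ forall i : int,
     ~~ isAlpha (om i) \/
     (isAlpha (om i) /\ exists j : int, (1 <= j)%R /\ H om (i + j) = H om i)].

(* Sigma_alpha = {alpha_1..alpha_M, beta}^Z  coded by option 'I_M,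
   Some i = alpha_(i+1), None = beta;
   Sigma_beta = {alpha, beta_1..beta_M}^Z coded by option 'I_M,
   Some i = beta_(i+1), None = alpha. *)
Definition phi_alpha (om : int -> Dsym M) : int -> option 'I_M :=
  fun n => match om n with Alpha i => Some i | Beta _ => None end.
Definition phi_beta (om : int -> Dsym M) : int -> option 'I_M :=
  fun n => match om n with Beta i => Some i | Alpha _ => None end.

End Dyck.

(* Uniform Bernoulli measure on A^Z (A a finite alphabet), given as the
   (Caratheodory) outer measure generated by cylinder sets
   [n; w] = {x | x (n+k) = w_k, k < size w} of mass #|A|^-(size w).
   On measurable sets it is the uniform Bernoulli (product) measure. *)
Section Bernoulli.
Variable R : realType.
Variable A : finType.

Definition cylinder (c : int * seq A) : set (int -> A) :=
  [set x | forall k : nat, (k < size c.2)%N -> x (c.1 + k%:Z)%R = nth (x 0%R) c.2 k].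

Definition cyl_mass (c : int * seq A) : \bar R :=
  ((#|A|%:R ^- size c.2 : R)%:E)%E.

Definition bernoulli_unif (S : set (int -> A)) : \bar R :=
  ereal_inf [set (\sum_(0 <= k <oo) cyl_mass (c k))%E
            | c in [set c : nat -> int * seq A |
                     S `<=` \bigcup_k cylinder (c k)]].
End Bernoulli.

Section Measures.
Variable R : realType.
Variable M : nat.

Definition mu_alpha (a b : R) (E : set (pt R)) : \bar R :=
  bernoulli_unif R (phi_alpha (M:=M) @` (pi_image (M:=M) a b E `&` B_alpha (M:=M))).

Definition mu_beta (a b : R) (E : set (pt R)) : \bar R :=
  bernoulli_unif R (phi_beta (M:=M) @` (pi_image (M:=M) a b E `&` B_beta (M:=M))).

Definition Leb3 (E : set (pt R)) : \bar R :=
  ((@lebesgue_measure R \x @lebesgue_measure R) \x @lebesgue_measure R)%E E.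

End Measures.

(* Main.v *)
From HB Require Import structures.
Require Import Defs.
From mathcomp Require Import all_boot all_order all_algebra.
From mathcomp Require Import all_classical all_reals all_analysis.
From mathcomp Require Import ring lra zify.
Import Order.TTheory GRing.Theory Num.Theory.
Import numFieldNormedType.Exports.
Local Open Scope ring_scope.
Local Open Scope classical_set_scope.

(** Off its boundary f_(a,b) maps the boxes Omega_gamma affinely onto boxes tiling the
    cube, and in part (i) the unstable coordinate depends only on the alpha-code of the
    future, with weight a for each alpha_k and 1 - M a for beta; the past letters are
    alpha_k with weight (1 - M b)/M and beta with weight M b.  Comparing Lebesgue measure
    with the Bernoulli measure on the four corresponding one-letter cylinders forces the
    parameters.

    Conversely, at those parameters f_(a,b) preserves Lebesgue measure and every alpha-cylinder
    of length n has Lebesgue measure at most (M+1)^(-n), so that Leb(E) <= mu_alpha(E) for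
    every Borel E.  Since M >= 2 the alpha-height drifts to -oo in the past almost surely;
    a point with drift is determined by its alpha-code, uniformly on cylinders, because the
    stack of unmatched alphas recovers both the central coordinate and the index of each
    beta.  Hence Borel sets are Caratheodory measurable for the outer measure mu_alpha,
    whose total mass is at most 1, and the inequality is an equality.

    Part (ii) is part (i) for the time reversal: the point reflection of the cube that
    exchanges the stable and unstable axes conjugates the inverse of f_(a,b) to f_(b,a). *)

Set Implicit Arguments. Unset Strict Implicit. Unset Printing Implicit Defensive.

(** * The Bernoulli outer measure *)

Section BernoulliOuter.
Variables (R : realType) (A : finType).
Hypothesis A_gt1 : (1 < #|A|)%N.
Local Open Scope ereal_scope.
Local Notation lam := (@bernoulli_unif R A).
Local Notation mass := (@cyl_mass R A).
Local Notation cyl := (@cylinder A).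

Let q_gt0 : (0 < #|A|%:R :> R)%R.
Proof. by rewrite ltr0n; apply: ltn_trans A_gt1. Qed.

Lemma cyl_mass_ge0 c : 0 <= mass c.
Proof. by rewrite lee_fin invr_ge0 exprn_ge0 // ltW. Qed.

(** Of the [n + k.+1] letters, [n] bring the mass below [e] and the other [k.+1] contribute at most
    [2 ^- k.+1], the alphabet having at least two letters. Summed over [k], such words cost at most
    [e]. *)
Lemma exists_long_word (e : R) (k : nat) : (0 < e)%R ->
  exists w : seq A, mass (0%:Z, w) <= (e / (2 ^ k.+1)%:R)%:E.
Proof.
move=> e0; have /card_gt0P[x0 _] : (0 < #|A|)%N by apply: ltn_trans A_gt1.
pose n := Num.bound e^-1.
have ne : (e^-1 < n%:R)%R by rewrite archi_boundP // invr_ge0 ltW.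
exists (nseq (n + k.+1) x0); rewrite lee_fin size_nseq.
rewrite ler_pdivlMr ?ltr0n ?expn_gt0 // mulrC ler_pdivrMr ?exprn_gt0 // exprD mulrA.
have h2 : ((2 ^ k.+1)%:R <= #|A|%:R ^+ k.+1 :> R)%R.
  by rewrite natrX lerXn2r ?nnegrE ?ler0n ?ler_nat.
apply: le_trans h2 _; rewrite ler_peMl ?exprn_ge0 ?(ltW q_gt0)//.
rewrite mulrC -ler_pdivrMr // div1r.
apply: (le_trans (ltW ne)).
have : (n%:R <= (#|A| ^ n)%:R :> R)%R by rewrite ler_nat ltnW // ltn_expl.
by rewrite natrX.
Qed.

Lemma bernoulli_unif_ge0 S : 0 <= lam S.
Proof. by apply: le_ereal_inf_tmp => _ [c _ <-]; apply: nneseries_ge0 => *; exact: cyl_mass_ge0. Qed.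

Lemma bernoulli_unif_le_cover (c : nat -> int * seq A) S :
  S `<=` \bigcup_k cyl (c k) -> lam S <= \sum_(0 <= k <oo) mass (c k).
Proof. by move=> Sc; apply: ereal_inf_lbound; exists c. Qed.

Lemma le_bernoulli_unif : {homo lam : S T / S `<=` T >-> S <= T}.
Proof.
move=> S T ST; apply: ereal_inf_le_tmp => _ [c Tc <-].
by exists c => //; apply: subset_trans ST Tc.
Qed.

(* A cover is an infinite sequence of cylinders, all of positive mass: it is padded with long words. *)
Lemma bernoulli_unif_cylinder c : lam (cyl c) <= mass c.
Proof.
apply/lee_addgt0Pr => e e0.
have [w wP] := choice (fun k => exists_long_word k e0).
apply: (@le_trans _ _ (\sum_(0 <= k <oo) mass (if k is k.+1 then (0%:Z, w k) else c))).
  by apply: bernoulli_unif_le_cover => x xc; exists 0%N.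
rewrite nneseries_recl //; last by move=> *; exact: cyl_mass_ge0.
rewrite leeD2l //.
have -> : \sum_(1 <= k <oo) mass (if k is k.+1 then (0%:Z, w k) else c) = \sum_(0 <= k <oo) mass (0%:Z, w k).
  rewrite -(@nneseries_addn _ (fun k => mass (if k is k.+1 then (0%:Z, w k) else c)) 1%N).
    by apply: eq_eseriesr => i _; rewrite addn1.
  by move=> i; exact: cyl_mass_ge0.
apply: le_trans (epsilon_trick0 xpredT (ltW e0)).
by apply: lee_nneseries => [i _ _|i _]; [exact: cyl_mass_ge0| exact: wP].
Qed.

Lemma bernoulli_unif0 : lam set0 = 0.
Proof.
apply/eqP; rewrite eq_le bernoulli_unif_ge0 andbT.
apply/lee_addgt0Pr => e e0; rewrite add0e.
have [w wP] := exists_long_word 0 e0.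
apply: (le_trans (le_bernoulli_unif (sub0set (cyl (0%:Z, w))))).
apply: (le_trans (bernoulli_unif_cylinder _)); apply: (le_trans wP).
by rewrite lee_fin expn1 ler_pdivrMr // ler_peMr ?ler1n // ltW.
Qed.

Lemma bernoulli_unif_sigma_subadditive : sigma_subadditive lam.
Proof.
move=> F; have [[i ioo]|] := pselect (exists i, lam (F i) = +oo).
  rewrite (eseries_pinfty _ _ ioo) ?leey// => n _.
  by rewrite -ltNye (lt_le_trans _ (bernoulli_unif_ge0 _)).
rewrite -forallNE => Foo; apply/lee_addgt0Pr => e e0.
have Gex n : exists G : nat -> int * seq A, F n `<=` \bigcup_k cyl (G k) /\
    \sum_(0 <= k <oo) mass (G k) <= lam (F n) + (e / (2 ^ n.+1)%:R)%:E.
  have fin : lam (F n) \is a fin_num.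
    rewrite ge0_fin_numE ?bernoulli_unif_ge0 // ltey; exact/eqP/Foo.
  have en : (0 < e / (2 ^ n.+1)%:R)%R by rewrite divr_gt0 // ltr0n expn_gt0.
  have [_ [c Fc <-] /ltW lec] := lb_ereal_inf_adherent en fin.
  by exists c.
have [G GP] := choice Gex.
(* A bijection of [nat] with [nat * nat] merges the countably many covers [G n] into a single
   one. *)
have /card_esym/ppcard_eqP[f] := card_nat2.
apply: (@le_trans _ _ (\sum_(0 <= k <oo) mass (G (f k).1 (f k).2))).
  apply: bernoulli_unif_le_cover => t [n _ /((GP n).1) [m _ tm]].
  by exists (f^-1%FUN (n, m)) => //=; rewrite invK ?inE.
rewrite nneseries_esumT; last by move=> *; exact: cyl_mass_ge0.
rewrite -(@reindex_esum R nat (nat * nat)%type setT setT f (fun p => mass (G p.1 p.2))); last first.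
  exact: bij.
apply: le_trans (epsilon_trick xpredT (fun n => bernoulli_unif_ge0 (F n)) (ltW e0)).
have -> : [set: nat * nat] = [set: nat] `*`` (fun=> setT) by apply/seteqP; split.
rewrite -(esum_esum (fun i j _ _ => cyl_mass_ge0 (G i j))).
rewrite -nneseries_esumT; last by move=> n; apply: esum_ge0 => *; exact: cyl_mass_ge0.
apply: lee_nneseries => [i _ _|i _]; first by apply: esum_ge0 => *; exact: cyl_mass_ge0.
rewrite -nneseries_esumT; last by move=> *; exact: cyl_mass_ge0.
exact: (GP i).2.
Qed.

Definition bernoulli_outer : {outer_measure set (int -> A) -> \bar R} :=
  HB.pack lam (isOuterMeasure.Build R (int -> A) lam bernoulli_unif0 bernoulli_unif_ge0
    le_bernoulli_unif bernoulli_unif_sigma_subadditive).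

Lemma bernoulli_unif_bigsetU (I : finType) (P : pred I) (F : I -> set (int -> A)) :
  lam (\bigcup_(i in [set i | P i]) F i) <= \sum_(i | P i) lam (F i).
Proof.
rewrite -big_enum /=.
have -> : \bigcup_(i in [set i | P i]) F i = \big[setU/set0]_(i <- enum P) F i.
  apply/seteqP; split => [t [i Pi Fi]|t].
    by rewrite -bigcup_seq; exists i => //=; rewrite mem_enum.
  rewrite -bigcup_seq => -[i /=]; rewrite mem_enum => Pi Fi; by exists i.
elim: (enum P) => [|i s IH]; first by rewrite !big_nil bernoulli_unif0.
rewrite !big_cons; apply: le_trans (leeD2l _ IH).
exact: (outer_measureU2 bernoulli_outer).
Qed.

End BernoulliOuter.

(** * Cylinders and drift of the height *)

Lemma cylinder_cons (A : finType) j (s : A) w x :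
  cylinder (j, s :: w) x <-> x j = s /\ cylinder (j + 1, w) x.
Proof.
split=> [xc|[xj xc] [|k] /= kw].
- split; first by have := xc 0%N isT; rewrite /= addr0.
  by move=> k /= kw; have := xc k.+1 kw; rewrite /= -addrA -intS.
- by rewrite addr0.
- by rewrite intS addrA xc.
Qed.

Lemma cylinder_rcons (A : finType) j (s : A) w x :
  cylinder (j, rcons w s) x <-> cylinder (j, w) x /\ x (j + (size w)%:Z) = s.
Proof.
elim: w j => [|t w IH] j /=.
  rewrite cylinder_cons addr0; split=> [[-> _]|[_ ->]]; split => //; exact: ltn0.
rewrite !cylinder_cons IH intS addrA; tauto.
Qed.

(** * Caratheodory measurability of unions of cylinders *)

Section BernoulliCaratheodory.
Variables (R : realType) (A : finType).
Hypothesis A_gt1 : (1 < #|A|)%N.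
Local Notation lam := (@bernoulli_unif R A).
Local Notation mass := (@cyl_mass R A).
Local Notation cyl := (@cylinder A).
Local Notation outer := (bernoulli_outer R A_gt1).

Let sum_mass (m : nat) : (\sum_(t : A) (#|A|%:R ^- m.+1 : R)%:E = (#|A|%:R ^- m : R)%:E)%E.
Proof.
have q0 : #|A|%:R != 0 :> R by rewrite pnatr_eq0 -lt0n; apply: ltn_trans A_gt1.
rewrite sumEFin sumr_const exprS -[_ *+ _]mulr_natl invfM mulrA mulfV //.
by rewrite mul1r.
Qed.

(** The Caratheodory inequality on a single cylinder, with [mass c] on the right: summed over a
    cover, these right-hand sides are exactly the sums whose infimum defines [lam]. *)
Let splits (L : set (int -> A)) c :=
  (lam (cyl c `&` L) + lam (cyl c `&` ~` L) <= mass c)%E.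

(** The [#|A|] one-letter extensions of a word have the same total mass as the word, so the
    inequality passes from the extensions to it. *)
Let splits_refine (L : set (int -> A)) c (e : A -> int * seq A) :
  (forall t, size (e t).2 = (size c.2).+1) ->
  (cyl c `<=` \bigcup_t cyl (e t)) ->
  (forall t, splits L (e t)) -> splits L c.
Proof.
move=> se ce sp; rewrite /splits /cyl_mass -sum_mass.
have sub (B : set (int -> A)) : (lam (cyl c `&` B) <= \sum_t lam (cyl (e t) `&` B))%E.
  apply: le_trans (bernoulli_unif_bigsetU R A_gt1 xpredT _).
  by apply: le_bernoulli_unif => x [/ce[t _ xt] Bx]; exists t.
apply: (le_trans (leeD (sub L) (sub (~` L)))).
rewrite -big_split /=; apply: lee_sum => t _.
by apply: (le_trans (sp t)); rewrite /cyl_mass se.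
Qed.

(** The word already fixes the letter at [n], so the cylinder is contained in the set or disjoint
    from it, and one of the two terms vanishes. *)
Let splits_inside n s j w k : (k < size w)%N -> n = j + k%:Z ->
  splits [set x : int -> A | x n = s] (j, w).
Proof.
move=> kw ->; have [v vP] : exists v, forall x, cyl (j, w) x -> x (j + k%:Z) = v.
  case: w kw => [//|t w] kw; exists (nth t (t :: w) k) => x xc.
  by rewrite xc //=; apply: set_nth_default.
have [vs|vs] := eqVneq v s.
  rewrite /splits [X in (_ + lam X)%E](_ : _ = set0) ?bernoulli_unif0 // ?adde0; last first.
    by apply/seteqP; split => // x [/vP xv]; apply; rewrite /= xv.
  by apply: le_trans (bernoulli_unif_cylinder R A_gt1 _); apply: le_bernoulli_unif => x [].
rewrite /splits [X in (lam X + _)%E](_ : _ = set0) ?bernoulli_unif0 // ?add0e; last first.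
  by apply/seteqP; split => // x [/vP xv] /= xs; move: vs; rewrite -xv xs eqxx.
by apply: le_trans (bernoulli_unif_cylinder R A_gt1 _); apply: le_bernoulli_unif => x [].
Qed.

(** The word is extended letter by letter towards [n], to the left or to the right, until it reaches
    [n]; [d] counts the positions in between. *)
Let splits_letter n s c : splits [set x : int -> A | x n = s] c.
Proof.
case: c => j w.
have left d : forall (j : int) w, n = j - 1 - d%:Z -> splits [set x : int -> A | x n = s] (j, w).
  elim: d => [|d IH] {}j {}w nE; apply: (@splits_refine _ _ (fun t => (j - 1, t :: w))) => //.
  - by move=> x xc; exists (x (j - 1)) => //; apply/cylinder_cons; rewrite subrK.
  - by move=> t; apply: (@splits_inside _ _ _ _ 0%N) => //; rewrite nE subr0 addr0.
  - by move=> x xc; exists (x (j - 1)) => //; apply/cylinder_cons; rewrite subrK.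
  - by move=> t; apply: IH; rewrite nE; lia.
have right d : forall w, n = j + (size w)%:Z + d%:Z -> splits [set x : int -> A | x n = s] (j, w).
  elim: d => [|d IH] {}w nE; apply: (@splits_refine _ _ (fun t => (j, rcons w t))).
  - by move=> t /=; rewrite size_rcons.
  - by move=> x xc; exists (x (j + (size w)%:Z)) => //; apply/cylinder_rcons.
  - by move=> t; apply: (@splits_inside _ _ _ _ (size w)); rewrite ?size_rcons // nE addr0.
  - by move=> t /=; rewrite size_rcons.
  - by move=> x xc; exists (x (j + (size w)%:Z)) => //; apply/cylinder_rcons.
  - by move=> t; apply: IH; rewrite size_rcons nE; lia.
have [nj|jn] := ltP n j; first by apply: (left (absz (j - 1 - n)%R) j w); lia.
have [nw|wn] := ltP n (j + (size w)%:Z).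
  by apply: (@splits_inside _ _ _ _ (absz (n - j)%R)); lia.
by apply: (right (absz (n - (j + (size w)%:Z))%R) w); lia.
Qed.

Lemma caratheodory_letter n s : outer.-caratheodory [set x : int -> A | x n = s].
Proof.
apply: le_caratheodory_measurable => X; apply: le_ereal_inf_tmp => _ [c Xc <-].
have sub (B : set (int -> A)) : (outer (X `&` B) <= \sum_(0 <= k <oo) lam (cyl (c k) `&` B))%E.
  apply: le_trans (outer_measure_sigma_subadditive outer _).
  by apply: (le_outer_measure outer) => x [/Xc[k _ xk] Bx]; exists k.
apply: (le_trans (leeD (sub _) (sub _))).
rewrite -nneseriesD; try by move=> *; exact: bernoulli_unif_ge0.
apply: lee_nneseries => [k _ _|k _]; first by apply: adde_ge0; exact: bernoulli_unif_ge0.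
exact: splits_letter.
Qed.

Lemma caratheodory_cylinder c : outer.-caratheodory (cyl c).
Proof.
case: c => j w; elim: w j => [|s w IH] j.
  rewrite (_ : cyl _ = ~` set0).
    by apply: caratheodory_measurable_setC; exact: caratheodory_measurable_set0.
  by apply/seteqP; split=> x _ => [[]|k].
rewrite (_ : cyl _ = [set x | x j = s] `&` cyl (j + 1, w)).
  by apply: caratheodory_measurable_setI => //; exact: caratheodory_letter.
by apply/seteqP; split => x; rewrite cylinder_cons.
Qed.

(** Words with a position form a countable type, so any union of cylinders is a countable one,
    enumerated by [unpickle]. *)
Lemma caratheodory_cylinders (P : set (int * seq A)) :
  outer.-caratheodory (\bigcup_(c in P) cyl c).
Proof.
pose F n := if (unpickle n : option (int * seq A)) is Some c then
  (if `[< P c >] then cyl c else set0) else set0.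
rewrite (_ : \bigcup_(c in P) cyl c = \bigcup_n F n).
  apply: caratheodory_measurable_bigcup => n; rewrite /F.
  case: unpickle => [c|]; last exact: caratheodory_measurable_set0.
  by case: asbool; [exact: caratheodory_cylinder | exact: caratheodory_measurable_set0].
apply/seteqP; split => [x [c Pc xc]|x [n _]].
  by exists (pickle c); [|rewrite /F pickleK asboolT].
by rewrite /F; case: unpickle => // c; case: asboolP => // Pc xc; exists c.
Qed.
End BernoulliCaratheodory.

(** * Almost sure drift of the height in the past *)

Definition letter_sign M (s : option 'I_M) : int := if s is Some _ then 1 else -1.

Definition height M (t : int -> option 'I_M) (j : int) (n : nat) : int :=
  \sum_(k < n) letter_sign (t (j + k%:Z)).

(** For a code [w], the height of the window from [- n] to [0] equals [- H w (- n)]; drifting thus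
    means that [H w] is unbounded below in the past. *)
Definition drifting M : set (int -> option 'I_M) :=
  [set t | forall K : nat, exists n : nat, K%:Z <= height t (- n%:Z) n].

Section Drift.
Variables (R : realType) (M : nat).
Hypothesis M_gt1 : (2 <= M)%N.
Local Notation A := (option 'I_M).
Local Notation lam := (@bernoulli_unif R A).

Lemma card_letters : #|{: A}| = M.+1.
Proof. by rewrite card_option card_ord. Qed.

Lemma card_letters_gt1 : (1 < #|{: A}|)%N.
Proof. by rewrite card_letters ltnS ltnW. Qed.

(* Any 0 < t0 < 1 with M t0 + 1 / t0 < M + 1 serves in the exponential Markov bound below. *)
Let t0 : R := 2 / 3.

Let weight (s : A) : R := t0 ^ letter_sign s.

Let sum_weight : \sum_s weight s = M%:R * t0 + t0^-1.
Proof.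
have -> : \sum_s weight s = weight None + \sum_(i < M) weight (Some i).
  rewrite (bigD1 None) //=; congr (_ + _).
  by rewrite (reindex_omap Some id) /=; [apply: eq_bigl => i; rewrite eqxx|case].
rewrite /weight /= sumr_const card_ord mulr_natl addrC.
done.
Qed.

Definition low_height (K n : nat) : set (int -> A) := [set t | height t (- n%:Z) n <= K%:Z].

(** As [t0 < 1], a word of height at most [K] has product of weights at least [t0 ^+ K], while the
    products over all words of length [n] sum to the [n]-th power of the sum of the weights. This
    bounds the number of such words, each of mass [M.+1%:R ^- n]. *)
Lemma bernoulli_unif_low_height (K n : nat) :
  (lam (low_height K n) <=
   (t0 ^- K * ((M%:R * t0 + t0^-1) / M.+1%:R) ^+ n)%:E)%E.
Proof.
have t00 : 0 < t0 by rewrite /t0; lra.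
pose F (f : {ffun 'I_n -> A}) := cylinder (- n%:Z, [seq f i | i <- enum 'I_n]).
pose P (f : {ffun 'I_n -> A}) := \sum_(i < n) letter_sign (f i) <= K%:Z.
apply: (@le_trans _ _ (lam (\bigcup_(f in [set f | P f]) F f))).
  apply: le_bernoulli_unif => t th; exists [ffun i : 'I_n => t (- n%:Z + i%:Z)].
    by rewrite /P /=; under eq_bigr do rewrite ffunE.
  move=> k /=; rewrite size_map size_enum_ord => kn.
  by rewrite (nth_map (Ordinal kn)) ?size_enum_ord // ffunE nth_enum_ord.
apply: (le_trans (bernoulli_unif_bigsetU R card_letters_gt1 _ _)).
apply: (@le_trans _ _ (\sum_(f | P f) (M.+1%:R ^- n : R)%:E)%E).
  apply: lee_sum => f _; apply: (le_trans (bernoulli_unif_cylinder R card_letters_gt1 _)).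
  by rewrite /cyl_mass /= size_map size_enum_ord card_letters.
have powE : (\sum_s weight s) ^+ n = \sum_(f : {ffun 'I_n -> A}) \prod_i weight (f i).
  by rewrite -(bigA_distr_bigA (fun=> weight)) prodr_const card_ord.
rewrite sumEFin lee_fin -sum_weight (expr_div_n (\sum_s weight s)) powE mulrA ler_pdivlMr ?exprn_gt0 ?ltr0n //.
rewrite mulr_suml [leRHS]mulr_sumr big_mkcond /=.
apply: ler_sum => f _; have Pw : \prod_i weight (f i) = t0 ^ (\sum_(i < n) letter_sign (f i)).
  symmetry; apply: (big_morph (fun z => t0 ^ z)) => // x y.
  by rewrite expfzDr // lt0r_neq0.
case: ifP => [Pf|_]; last by rewrite mulr_ge0 ?invr_ge0 ?exprn_ge0 ?(ltW t00) // prodr_ge0 // => i _; exact: exprz_ge0 (ltW t00).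
rewrite mulVf ?expf_neq0 ?pnatr_eq0 // Pw -ler_pdivrMl ?invr_gt0 ?exprn_gt0 // invrK mulr1.
(* The excess [d] reduces the comparison of integer powers to [t0 ^+ d <= 1]. *)
have [d KE] : exists d : nat, K%:Z = \sum_(i < n) letter_sign (f i) + d%:Z.
  by exists (absz (K%:Z - \sum_(i < n) letter_sign (f i))%R); move: Pf; rewrite /P; lia.
rewrite exprnP KE expfzDr ?lt0r_neq0 // ler_piMr ?exprz_ge0 ?(ltW t00) // -exprnP.
by rewrite exprn_ile1 ?(ltW t00) // /t0; lra.
Qed.

(** A code without drift stays below some level [K] in every past window; for fixed [K] the Markov
    bound decays geometrically in [n], and there are countably many [K]. *)
Lemma bernoulli_unif_not_drifting : lam (~` @drifting M) = 0%E.
Proof.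
pose rho : R := (M%:R * t0 + t0^-1) / M.+1%:R.
have M2 : 2 <= M%:R :> R by rewrite ler_nat.
have rho0 : 0 <= rho by rewrite /rho divr_ge0 // addr_ge0 ?mulr_ge0 ?invr_ge0 // /t0; lra.
(* With [t0 = 2 / 3] this says [M / 3 > 1 / 2], which [M >= 2] gives. *)
have rho1 : rho < 1.
  rewrite /rho ltr_pdivrMr ?ltr0n // mul1r -natr1 /t0 invf_div; lra.
have low K : lam (\bigcap_n low_height K n) = 0%E.
  apply/eqP; rewrite eq_le bernoulli_unif_ge0 andbT; apply/lee_addgt0Pr => e e0; rewrite add0e.
  have /cvgrPdist_lt/(_ e e0) [n _ /(_ n (leqnn n))] :
      (fun n => t0 ^- K * rho ^+ n) @ \oo --> (0 : R).
    rewrite -[X in _ --> X](mulr0 (t0 ^- K)); apply: cvgMr; apply: cvg_expr.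
    by rewrite ger0_norm.
  rewrite sub0r normrN => small.
  apply: (@le_trans _ _ (lam (low_height K n))).
    by apply: le_bernoulli_unif => t /(_ n I).
  apply: (le_trans (bernoulli_unif_low_height K n)); rewrite lee_fin.
  exact: ltW (le_lt_trans (ler_norm _) small).
apply/eqP; rewrite eq_le bernoulli_unif_ge0 andbT.
have : (lam (\bigcup_K (\bigcap_n low_height K n)) <= 0)%E.
  apply: (le_trans (outer_measure_sigma_subadditive (bernoulli_outer R card_letters_gt1) _)).
  by rewrite eseries0 // => K _ _; exact: low.
apply: le_trans; apply: le_bernoulli_unif => t /existsNP[K] /forallNP tK.
exists K => // n _ /=; have := tK n; rewrite leNgt => /negP; rewrite negbK; exact: ltW.
Qed.
End Drift.

(** * The boxes of the map and their images *)

Definition box3 (R : realType) (x1 y1 x2 y2 x3 y3 : R) : set (pt R) :=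
  (`]x1, y1[%classic `*` `]x2, y2[%classic) `*` `]x3, y3[%classic.

Lemma box3E (R : realType) (x1 y1 x2 y2 x3 y3 : R) p :
  box3 x1 y1 x2 y2 x3 y3 p <->
  [/\ x1 < p.1.1, p.1.1 < y1 & x2 < p.1.2] /\ [/\ p.1.2 < y2, x3 < p.2 & p.2 < y3].
Proof.
rewrite /box3 /= !in_itv /=; split.
  by case=> -[/andP[-> ->] /andP[-> ->]] /andP[-> ->].
by case=> -[-> -> ->] [-> -> ->].
Qed.

Lemma open_box3 (R : realType) (x1 y1 x2 y2 x3 y3 : R) : open (box3 x1 y1 x2 y2 x3 y3).
Proof.
rewrite /box3 (_ : _ `*` _ =
  ((fst \o fst) @^-1` `]x1, y1[%classic `&` (snd \o fst) @^-1` `]x2, y2[%classic)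
   `&` snd @^-1` `]x3, y3[%classic) //.
apply: openI; first apply: openI.
- apply: open_comp; last exact: itv_open.
  by move=> p _; apply: continuous_comp; apply: cvg_fst.
- apply: open_comp; last exact: itv_open.
  by move=> p _; apply: continuous_comp; [apply: cvg_fst|apply: cvg_snd].
- by apply: open_comp; [move=> p _; apply: cvg_snd|exact: itv_open].
Qed.

Section Boxes.
Variables (R : realType) (M : nat).
Hypothesis M_gt0 : (0 < M)%N.

Definition obox (a : R) (g : Dsym M) : set (pt R) :=
  match g with
  | Alpha i => box3 (i%:R * a) (i.+1%:R * a) 0 1 0 1
  | Beta i => box3 (M%:R * a) 1 (i%:R / M%:R) (i.+1%:R / M%:R) 0 1
  end.

(** The image of [obox a g] under [fpiece a b g]. The alpha images fill the slab of stable height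
    [1 - M b] side by side in the central direction; the beta images are stacked above it in slabs
    of thickness [b]. *)
Definition vbox (b : R) (g : Dsym M) : set (pt R) :=
  match g with
  | Alpha i => box3 0 1 (i%:R / M%:R) (i.+1%:R / M%:R) 0 (1 - M%:R * b)
  | Beta i => box3 0 1 0 1 (1 - M%:R * b + i%:R * b) (1 - M%:R * b + i.+1%:R * b)
  end.

Definition fpiece_inv (a b : R) (g : Dsym M) (p : pt R) : pt R :=
  match g with
  | Alpha i => ((a * p.1.1 + i%:R * a, M%:R * p.1.2 - i%:R), p.2 / (1 - M%:R * b))
  | Beta i => (((1 - M%:R * a) * p.1.1 + M%:R * a, p.1.2 / M%:R + i%:R / M%:R),
                (p.2 - (1 - M%:R * b + i%:R * b)) / b)
  end.

(** Strict bounds for one slot and weak bounds for the other allow an open box to be compared with a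
    closed one. *)
Lemma slot_unique (h x : R) (i j : 'I_M) : 0 < h ->
  i%:R * h < x -> x < i.+1%:R * h -> j%:R * h <= x -> x <= j.+1%:R * h -> i = j.
Proof.
move=> h0 ix xi jx xj; apply: val_inj => /=.
have ij : i%:R < j.+1%:R :> R by rewrite -(ltr_pM2r h0); apply: lt_le_trans xj.
have ji : j%:R < i.+1%:R :> R by rewrite -(ltr_pM2r h0); apply: le_lt_trans xi.
by rewrite !ltr_nat !ltnS in ij ji; apply/eqP; rewrite eqn_leq ij ji.
Qed.

Lemma Omega_closed_bounds (a : R) (g : Dsym M) p : Omega a g p ->
  match g with
  | Alpha i => i%:R * a <= p.1.1 <= i.+1%:R * a /\ p.1.1 < i.+1%:R * a /\ 0 <= p.1.2 <= 1
  | Beta i => M%:R * a <= p.1.1 <= 1 /\ i%:R / M%:R <= p.1.2 <= i.+1%:R / M%:R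
  end /\ 0 <= p.2 <= 1.
Proof.
case: g => i [] /=; first by move=> [/andP[-> u1] ->] ->; rewrite ltW.
case: ifP => [_ [-> /andP[-> c1]] -> |iM]; first by rewrite ltW.
have iE : i.+1 = M by have := ltn_ord i; lia.
have iE' : M.-1 = i by lia.
move=> [-> /andP[]]; rewrite iE' => -> c1 ->.
by rewrite iE divff // pnatr_eq0 -lt0n.
Qed.

Lemma obox_sub_Omega (a : R) (g : Dsym M) : obox a g `<=` Omega a g.
Proof.
case: g => i p /box3E[[u0 u1 c0] [c1 s0 s1]]; rewrite /Omega /= (ltW s0) (ltW s1).
  by split=> //; rewrite (ltW u0) u1 (ltW c0) (ltW c1).
split=> //; case: ifP => /= [_|iM]; first by rewrite (ltW u0) (ltW u1) (ltW c0) c1.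
have iE : i.+1 = M by have := ltn_ord i; lia.
have iE' : M.-1 = i by lia.
rewrite iE' (ltW u0) (ltW u1) (ltW c0); split=> //=; apply: ltW.
by rewrite iE divff ?pnatr_eq0 -?lt0n // in c1.
Qed.

(** An interior point may be shifted by [e / 2] in all coordinates at once, up or down; the weak
    bounds at the two shifted points are strict bounds at [p]. *)
Lemma interior_Omega (a : R) (g : Dsym M) : interior (Omega a g : set (pt R)) = obox a g.
Proof.
apply/seteqP; split; last first.
  rewrite -open_subsetE; first by exact: obox_sub_Omega.
  by case: g => i; exact: open_box3.
move=> p /nbhs_ballP[e /= e0 ep]; have e2 : 0 < e / 2 by rewrite divr_gt0.
have e2e : e / 2 < e by rewrite ltr_pdivrMr // ltr_pMr // ltr1n.
have near (x : R) : ball x e x by exact: ballxx.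
have up (x : R) : ball x e (x + e / 2).
  by rewrite /ball /= opprD addrA subrr sub0r normrN gtr0_norm.
have down (x : R) : ball x e (x - e / 2).
  by rewrite /ball /= opprB addrC subrK gtr0_norm.
have {}ep u c s : ball p.1.1 e u -> ball p.1.2 e c -> ball p.2 e s -> Omega a g ((u, c), s).
  by move=> ? ? ?; apply: ep.
have := Omega_closed_bounds (ep _ _ _ (up _) (up _) (up _)).
have := Omega_closed_bounds (ep _ _ _ (down _) (down _) (down _)).
move: e2; clear; move: (e / 2) => d d0.
case: g => i /=.
  move=> [[/andP[u0 _] [_ /andP[c0 _]]] /andP[s0 _]] [[/andP[_ u1] [_ /andP[_ c1]]] /andP[_ s1]].
  by apply/box3E; split; split; lra.
move=> [[/andP[u0 _] /andP[c0 _]] /andP[s0 _]] [[/andP[_ u1] /andP[_ c1]] /andP[_ s1]].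
by apply/box3E; split; split; lra.
Qed.

Section Params.
Variables (a b : R).
Hypotheses (a_gt0 : 0 < a) (Ma_lt1 : M%:R * a < 1).
Hypotheses (b_gt0 : 0 < b) (Mb_lt1 : M%:R * b < 1).

Local Lemma Mr_gt0 : 0 < M%:R :> R. Proof. by rewrite ltr0n. Qed.
Local Lemma ord_succ_le (i : 'I_M) : i%:R + 1 <= M%:R :> R.
Proof. by rewrite natr1 ler_nat. Qed.
Local Lemma Mr_inv_gt0 : 0 < M%:R^-1 :> R. Proof. by rewrite invr_gt0 Mr_gt0. Qed.
Local Hint Resolve Mr_gt0 Mr_inv_gt0 : core.
Local Lemma Mr_mulV : M%:R * M%:R^-1 = 1 :> R. Proof. by rewrite mulfV // lt0r_neq0. Qed.

(** The code names an open box whereas [fab] picks its branch by [Omega]; this identifies the two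
    letters along an orbit. *)
Lemma obox_Omega_inj (g h : Dsym M) p : obox a g p -> Omega a h p -> g = h.
Proof.
have [ha0 ha1] := conj a_gt0 Ma_lt1.
move=> gp /Omega_closed_bounds hp.
case: g gp => i /box3E[[u0 u1 c0] [c1 s0 s1]]; case: h hp => j /= [].
- move=> [/andP[ju uj] _] _; congr Alpha; exact: (slot_unique a_gt0 u0 u1 ju uj).
- move=> [/andP[ju _] _] _; have := ler_wpM2r (ltW a_gt0) (ord_succ_le i).
  by rewrite natr1 => H; exfalso; lra.
- move=> [_ [uj _]] _; have := ler_wpM2r (ltW a_gt0) (ord_succ_le j).
  by rewrite natr1 => H; exfalso; lra.
- move=> [_ /andP[jc cj]] _; congr Beta; exact: (slot_unique Mr_inv_gt0 c0 c1 jc cj).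
Qed.

Lemma obox_inj (g h : Dsym M) p : obox a g p -> obox a h p -> g = h.
Proof. by move=> gp /obox_sub_Omega; exact: obox_Omega_inj. Qed.

Lemma vbox_inj (g h : Dsym M) p : vbox b g p -> vbox b h p -> g = h.
Proof.
have [hb0 hb1] := conj b_gt0 Mb_lt1.
case: g => i /box3E[[u0 u1 c0] [c1 s0 s1]]; case: h => j /box3E[[u0' u1' c0'] [c1' s0' s1']].
- congr Alpha; exact: (slot_unique Mr_inv_gt0 c0 c1 (ltW c0') (ltW c1')).
- have : 0 <= j%:R * b by rewrite mulr_ge0 // ltW.
  by move=> H; exfalso; lra.
- have : 0 <= i%:R * b by rewrite mulr_ge0 // ltW.
  by move=> H; exfalso; lra.
- congr Beta; apply: (slot_unique b_gt0 (x := p.2 - (1 - M%:R * b))); lra.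
Qed.

Lemma obox_cube (g : Dsym M) p : obox a g p -> box3 0 1 0 1 0 1 p.
Proof.
have [ha0 ha1] := conj a_gt0 Ma_lt1.
case: g => i /box3E[[u0 u1 c0] [c1 s0 s1]]; apply/box3E; rewrite -?natr1 in u1 c1 s1 *.
  have ia := ler_wpM2r (ltW a_gt0) (ord_succ_le i).
  have : 0 <= i%:R * a by rewrite mulr_ge0 // ltW.
  by split; split; lra.
have ia := ler_wpM2r (ltW Mr_inv_gt0) (ord_succ_le i); rewrite Mr_mulV in ia.
have : 0 <= i%:R / M%:R :> R by rewrite mulr_ge0 // ltW.
have : 0 < M%:R * a by rewrite mulr_gt0.
by split; split; lra.
Qed.

Lemma vbox_cube (g : Dsym M) p : vbox b g p -> box3 0 1 0 1 0 1 p.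
Proof.
have [hb0 hb1] := conj b_gt0 Mb_lt1.
case: g => i /box3E[[u0 u1 c0] [c1 s0 s1]]; apply/box3E; rewrite -?natr1 in u1 c1 s1 *.
  have ia := ler_wpM2r (ltW Mr_inv_gt0) (ord_succ_le i); rewrite Mr_mulV in ia.
  have : 0 <= i%:R / M%:R :> R by rewrite mulr_ge0 // ltW.
  have : 0 < M%:R * b by rewrite mulr_gt0.
  by split; split; lra.
have ia := ler_wpM2r (ltW b_gt0) (ord_succ_le i).
have : 0 <= i%:R * b by rewrite mulr_ge0 // ltW.
by split; split; lra.
Qed.

Local Lemma sub1Mb_gt0 : 0 < 1 - M%:R * b. Proof. by rewrite subr_gt0. Qed.
Local Lemma sub1Ma_gt0 : 0 < 1 - M%:R * a. Proof. by rewrite subr_gt0. Qed.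

Local Hint Resolve sub1Mb_gt0 sub1Ma_gt0 : core.

Lemma fpieceK (g : Dsym M) : cancel (fpiece a b g) (fpiece_inv a b g).
Proof.
have [na nb nM] := And3 (lt0r_neq0 a_gt0) (lt0r_neq0 b_gt0) (lt0r_neq0 Mr_gt0).
have [nb1 na1] := conj (lt0r_neq0 sub1Mb_gt0) (lt0r_neq0 sub1Ma_gt0).
by case: g => i [[u c] s] /=; congr ((_, _), _); rewrite -?natr1; field; rewrite ?na ?nb ?nM ?nb1 ?na1.
Qed.

Lemma fpiece_invK (g : Dsym M) : cancel (fpiece_inv a b g) (fpiece a b g).
Proof.
have [na nb nM] := And3 (lt0r_neq0 a_gt0) (lt0r_neq0 b_gt0) (lt0r_neq0 Mr_gt0).
have [nb1 na1] := conj (lt0r_neq0 sub1Mb_gt0) (lt0r_neq0 sub1Ma_gt0).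
by case: g => i [[u c] s] /=; congr ((_, _), _); rewrite -?natr1; field; rewrite ?na ?nb ?nM ?nb1 ?na1.
Qed.

Lemma vbox_fpiece (g : Dsym M) p : obox a g p -> vbox b g (fpiece a b g p).
Proof.
have [ha0 hb0 ha1 hb1] := And4 a_gt0 b_gt0 Ma_lt1 Mb_lt1.
case: g => i /box3E[[u0 u1 c0] [c1 s0 s1]]; apply/box3E => /=; rewrite -!natr1 in u1 c1 *.
  rewrite ltr_pdivlMr // ltr_pdivrMr // mulrDl div1r; do ! split.
  - lra.
  - lra.
  - by rewrite ltrDr mulr_gt0.
  - by rewrite addrC ler_ltD // ltr_pdivrMr // mulVf ?lt0r_neq0.
  - exact: mulr_gt0.
  - by rewrite gtr_pMr.
rewrite ltr_pdivlMr // ltr_pdivrMr //; do ! split.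
- lra.
- lra.
- by move: c0; rewrite ltr_pdivrMr // mulrC subr_gt0.
- by move: c1; rewrite ltr_pdivlMr // mulrC; lra.
- have := mulr_gt0 b_gt0 s0; lra.
- have : b * p.2 < b by rewrite gtr_pMr.
  lra.
Qed.

Lemma obox_fpiece_inv (g : Dsym M) p : vbox b g p -> obox a g (fpiece_inv a b g p).
Proof.
have [ha0 hb0 ha1 hb1] := And4 a_gt0 b_gt0 Ma_lt1 Mb_lt1.
case: g => i /box3E[[u0 u1 c0] [c1 s0 s1]]; apply/box3E => /=; rewrite -!natr1 in s1 c1 *.
  do ! split.
  - by rewrite ltrDr mulr_gt0.
  - have : a * p.1.1 < a by rewrite gtr_pMr.
    lra.
  - by move: c0; rewrite ltr_pdivrMr // mulrC subr_gt0.
  - by move: c1; rewrite ltr_pdivlMr // mulrC; lra.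
  - exact: divr_gt0.
  - by rewrite ltr_pdivrMr // mul1r.
do ! split.
- by rewrite ltrDr mulr_gt0.
- have : (1 - M%:R * a) * p.1.1 < 1 - M%:R * a by rewrite gtr_pMr.
  lra.
- by rewrite ltrDr mulr_gt0.
- by rewrite mulrDl addrC ler_ltD // ltr_pdivrMr // div1r mulVf ?lt0r_neq0.
- by rewrite divr_gt0 // subr_gt0.
- rewrite ltr_pdivrMr //; lra.
Qed.

End Params.
End Boxes.

(** Each letter both locates the point and selects the branch, so the relation [fab] becomes an
    equation. *)
Definition coded_by (R : realType) M (a b : R) (w : int -> Dsym M) (o : int -> pt R) :=
  forall n, obox a (w n) (o n) /\ o (n + 1) = fpiece a b (w n) (o n).

Definition coded (R : realType) M (a b : R) (x : pt R) (w : int -> Dsym M) :=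
  exists2 o, o 0 = x & coded_by a b w o.

Lemma pi_imageE (R : realType) M (a b : R) E : (0 < M)%N -> 0 < a -> M%:R * a < 1 ->
  pi_image (M:=M) a b E = [set w | exists2 x, E x & coded a b x w].
Proof.
move=> M0 a0 a1; apply/seteqP; split=> [w [x [ [Ex _] [ o [ [ox oU] ow]]]]|w [x Ex [ o ox ow]]].
  exists x => //; exists o => // n; have /= := ow n; rewrite interior_Omega // => on.
  split => //; have [_ ofab] := oU n; have [g [gon ofE]] := ofab.
  by rewrite ofE (obox_Omega_inj M0 a0 a1 on gon).
have oU : orbitU M a b x o.
  split=> // n; have [on onE] := ow n; split.
    by exists (w n) => //; rewrite interior_Omega.
  by exists (w n); split => //; apply: obox_sub_Omega.
exists x; split; first by split => //; exists o.
by exists o; split => // n; rewrite interior_Omega //; have [] := ow n.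
Qed.

(** * Heights, stacks and contraction *)

Section Heights.
Variable M : nat.
Implicit Types (w : int -> Dsym M) (t : int -> option 'I_M).

Lemma heightS t j n : height t j n.+1 = height t j n + letter_sign (t (j + n%:Z)).
Proof. by rewrite /height big_ord_recr. Qed.

Lemma letter_sign_phi_alpha w n : letter_sign (phi_alpha w n) = sgn (w n).
Proof. by rewrite /phi_alpha; case: (w n). Qed.

Lemma height_bound t j n : `|height t j n| <= n%:Z.
Proof.
elim: n => [|n IH]; first by rewrite /height big_ord0.
by rewrite heightS; move: IH; case: (t _) => /= *; lia.
Qed.

Lemma height_split t j m n : height t j (m + n) = height t j m + height t (j + m%:Z) n.
Proof.
elim: n => [|n IH]; first by rewrite addn0 /height big_ord0 addr0.
by rewrite addnS !heightS IH PoszD !addrA.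
Qed.

Lemma HS w i : H w (i + 1) = H w i + sgn (w i).
Proof.
have HN n : H w (- n%:Z) = - \sum_(0 <= k < n) sgn (w (- n%:Z + k%:Z)).
  case: n => [|n]; first by rewrite /H oppr0 /= !big_geq // oppr0.
  by rewrite /H /=.
case: i => n.
  by rewrite /H -PoszD /= addn1 big_nat_recr.
have -> : Negz n + 1 = - n%:Z by rewrite NegzE; lia.
rewrite NegzE !HN big_nat_recl // addr0 opprD addrAC addNr add0r.
by congr (- _); apply: eq_bigr => k _; congr (sgn (w _)); lia.
Qed.

Lemma H_height w j n : H w (j + n%:Z) = H w j + height (phi_alpha w) j n.
Proof.
elim: n => [|n IH]; first by rewrite /height big_ord0 !addr0.
by rewrite heightS letter_sign_phi_alpha addrA -IH -HS intS addrA addrAC.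
Qed.

Lemma H_bound w i : `|H w i| <= `|i|.
Proof.
have H0 : H w 0 = 0 by rewrite /H /= big_geq.
case: i => n.
  by have := H_height w 0 n; have := height_bound (phi_alpha w) 0 n; rewrite add0r H0; lia.
have := H_height w (Negz n) n.+1; have := height_bound (phi_alpha w) (Negz n) n.+1.
by rewrite (_ : Negz n + n.+1%:Z = 0) ?H0 ?NegzE; lia.
Qed.

Definition past_matched w := forall i, ~~ isAlpha (w i) ->
  exists j : int, 1 <= j /\ H w (i - j + 1) = H w (i + 1).

(** A discrete intermediate value argument: going back from a beta at [i], the height starts one
    above [H w (i + 1)], moves by steps of one, and by drift falls to that level or below, so it
    meets it. *)
Lemma drifting_past_matched w : drifting (phi_alpha w) -> past_matched w.
Proof.
move=> dr i wi; have [m hm] := dr (absz i).+2.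
have mK := le_trans hm (le_trans (ler_norm _) (height_bound _ _ _)).
have Hm : H w (- m%:Z) <= H w (i + 1).
  have := H_height w (- m%:Z) m; rewrite addNr (_ : H w 0 = 0); last by rewrite /H /= big_geq.
  have := H_bound w (i + 1); lia.
have [n fn] : exists n : nat, H w (i - n%:Z) = H w (i + 1).
  have : H w (i - (absz (i + m%:Z)%R)%:Z) <= H w (i + 1).
    by rewrite (_ : i - _ = - m%:Z) //; lia.
  elim: (absz _) => [|n IH].
    by rewrite subr0 HS; case: (w i) wi => //= k _; lia.
  have [/IH//|fn] := lerP (H w (i - n%:Z)) (H w (i + 1)).
  move=> fS; exists n.+1; move: fn fS; have -> : i - n%:Z = i - n.+1%:Z + 1 by lia.
  by rewrite [X in _ < X]HS; case: (w (i - n.+1%:Z)) => /= *; lia.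
exists n.+1%:Z; split=> //; rewrite -fn; congr (H w _); lia.
Qed.
End Heights.

(** The unmatched alphas of the window of length [n] from [j], most recent first. A beta that meets
    the empty stack leaves it empty. *)
Fixpoint stack M (t : int -> option 'I_M) (j : int) (n : nat) : seq 'I_M :=
  if n is k.+1 then
    (if t (j + k%:Z) is Some i then i :: stack t j k else behead (stack t j k))
  else [::].

(** The two differ only at a beta on the empty stack, which lowers the height but not the size. *)
Lemma height_le_stack M (t : int -> option 'I_M) j n : height t j n <= (size (stack t j n))%:Z.
Proof.
elim: n => [|n IH]; first by rewrite /height big_ord0.
by rewrite heightS /=; case: (t _) => [i|] /=; rewrite ?size_behead; lia.
Qed.

Lemma eq_stack M (t t' : int -> option 'I_M) j n :
  (forall k, (k < n)%N -> t (j + k%:Z) = t' (j + k%:Z)) -> stack t j n = stack t' j n.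
Proof.
elim: n => //= n IH tt; rewrite tt // IH // => k kn; apply: tt; exact: ltnW.
Qed.

(** * Coded orbits: recovering the coordinates from the alpha-code *)

Section Orbits.
Variables (R : realType) (M : nat) (a b : R).
Hypothesis M_gt1 : (2 <= M)%N.
Hypotheses (a_gt0 : 0 < a) (Ma_lt1 : M%:R * a < 1).
Hypotheses (b_gt0 : 0 < b) (Mb_lt1 : M%:R * b < 1).
Implicit Types (w : int -> Dsym M) (o : int -> pt R).

Local Lemma M_gt0 : (0 < M)%N. Proof. exact: ltnW. Qed.
Local Lemma Mreal_gt0 : 0 < M%:R :> R. Proof. by rewrite ltr0n M_gt0. Qed.

(** The inverse branch of multiplication by [M] modulo 1: it puts [i] in front of the [M]-adic
    digits of [y]. *)
Definition push (i : 'I_M) (y : R) : R := (y + i%:R) / M%:R.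

Lemma push_itv (i : 'I_M) y : 0 < y < 1 -> i%:R / M%:R < push i y < i.+1%:R / M%:R.
Proof.
by move=> /andP[y0 y1]; rewrite /push !ltr_pM2r ?invr_gt0 ?Mreal_gt0 // -natr1; apply/andP; split; lra.
Qed.

Lemma push01 i y : 0 < y < 1 -> 0 < push i y < 1.
Proof.
move=> /push_itv - /(_ i) /andP[lo hi]; apply/andP; split.
  by apply: le_lt_trans lo; rewrite divr_ge0.
apply: lt_le_trans hi _; rewrite ler_pdivrMr ?Mreal_gt0 // mul1r ler_nat; exact: ltn_ord.
Qed.

Lemma foldr_push01 y st : 0 < y < 1 -> 0 < foldr push y st < 1.
Proof. by move=> y01; elim: st => //= i st IH; apply: push01. Qed.

Lemma foldr_push_dist y y' st : 0 < y < 1 -> 0 < y' < 1 ->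
  `|foldr push y st - foldr push y' st| <= M%:R^-1 ^+ size st.
Proof.
move=> /andP[y0 y1] /andP[y0' y1']; elim: st => [|i st IH] /=.
  by rewrite expr0 ler_norml; apply/andP; split; lra.
rewrite /push -mulrBl opprD addrACA subrr addr0 normrM exprSr.
by rewrite [`|M%:R^-1|]ger0_norm ?invr_ge0 // ler_wpM2r ?invr_ge0.
Qed.

Lemma coded_by01 w o (n : int) : coded_by a b w o -> box3 0 1 0 1 0 1 (o n).
Proof. by move=> co; have [on _] := co n; apply: obox_cube on; rewrite ?M_gt0. Qed.

(* The stack read off from the alpha-code alone records the leading M-adic
   digits of the central coordinate; a beta can only pop the digit it matches. *)
Lemma coded_by_stack w o j (n : nat) : coded_by a b w o ->
  exists2 y, 0 < y < 1 & (o (j + n%:Z)).1.2 = foldr push y (stack (phi_alpha w) j n).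
Proof.
move=> co; elim: n => [|n [y y01 IH]].
  have /box3E[[_ _ c0] [c1 _ _]] := coded_by01 j co.
  by exists (o j).1.2; rewrite ?addr0 // c0.
have [] := co (j + n%:Z); rewrite -addrA -PoszD addn1 /= /phi_alpha.
case: (w (j + n%:Z)) => [i|k] /box3E[[_ _ c0] [c1 _ _]] -> /=.
  by exists y => //; rewrite -/(phi_alpha w) IH /push mulrDl.
case st : (stack _ j n) IH => [|i s] /= IH.
  (* The stack is empty, so the new central coordinate itself is the witness. *)
  exists (M%:R * (o (j + n%:Z)).1.2 - k%:R) => //.
  move: c0 c1; rewrite ltr_pdivrMr ?Mreal_gt0 // ltr_pdivlMr ?Mreal_gt0 // -natr1 ![_ * M%:R]mulrC.
  by move=> *; apply/andP; split; lra.
exists y => //; have /push_itv - /(_ i) /andP[p0 p1] := foldr_push01 s y01.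
have ik : i = k.
  apply: (slot_unique (h := M%:R^-1) (x := (o (j + n%:Z)).1.2)); rewrite ?invr_gt0 ?Mreal_gt0 ?IH ?(ltW p0) ?(ltW p1) //.
  - by rewrite -IH ltW.
  - by rewrite -IH ltW.
by rewrite IH -ik /push mulrC divfK ?addrK // lt0r_neq0 // Mreal_gt0.
Qed.

(** The central coordinate lies in the slot of the digit on top of the stack and also in the slot of
    the beta. *)
Lemma coded_by_pop w o j (n : nat) i s k : coded_by a b w o ->
  stack (phi_alpha w) j n = i :: s -> w (j + n%:Z) = Beta k -> i = k.
Proof.
move=> co st wk; have [y y01] := coded_by_stack j n co; rewrite st /= => IH.
have /push_itv - /(_ i) /andP[p0 p1] := foldr_push01 s y01.
have [] := co (j + n%:Z); rewrite wk => /box3E[[_ _ c0] [c1 _ _]] _.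
apply: (slot_unique (h := M%:R^-1) (x := (o (j + n%:Z)).1.2)); rewrite ?invr_gt0 ?Mreal_gt0 ?IH ?(ltW p0) ?(ltW p1) //.
- by rewrite -IH ltW.
- by rewrite -IH ltW.
Qed.

(** The alpha part of the Dyck normal form of a window is the stack of its alpha-code. Betas that
    find it empty join the beta part, and every other beta matches the top, so the product is never
    zero. *)
Lemma coded_Sigma_D x w : coded a b x w -> Sigma_D w.
Proof.
move=> [ o _ co] j k _; rewrite /window; move: (absz _).+1 => m.
suff [bs ->] : exists bs, dyck_prod [seq w (j + n%:Z) | n <- iota 0 m] =
    Some (bs, stack (phi_alpha w) j m) by [].
elim: m => [|m [bs IH]]; first by exists [::].
have stS : stack (phi_alpha w) j m.+1 =
    if w (j + m%:Z) is Alpha i then i :: stack (phi_alpha w) j m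
    else behead (stack (phi_alpha w) j m).
  by rewrite /= {1}/phi_alpha; case: (w _).
rewrite stS -addn1 iotaD map_cat /dyck_prod foldl_cat -/(dyck_prod _) IH [foldl _ _ _]/= add0n.
case wm : (w (j + m%:Z)) => [i|i] /=; first by exists bs.
case st : (stack _ j m) => [|i' s] /=; first by exists (rcons bs i).
by rewrite (coded_by_pop co st wm) eqxx; exists bs.
Qed.

Lemma drifting_B_alpha x w : coded a b x w -> drifting (phi_alpha w) -> B_alpha w.
Proof.
move=> cx dr; split; first exact: coded_Sigma_D cx.
move=> i; case: (boolP (isAlpha (w i))) => wi; [by left|right; split => //].
exact: drifting_past_matched.
Qed.

Section Contraction.
Variable kappa : R.
Hypotheses (kappa_ge0 : 0 <= kappa) (a_le : a <= kappa) (a1_le : 1 - M%:R * a <= kappa).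
Hypotheses (b_le : b <= kappa) (b1_le : 1 - M%:R * b <= kappa) (M_le : M%:R^-1 <= kappa).

(** All betas share one branch of [tau], so the alpha-code of the future fixes the branches, each
    with an inverse of slope at most [kappa]. *)
Lemma unstable_contraction w w' o o' j (n : nat) : coded_by a b w o -> coded_by a b w' o' ->
  (forall k, (k < n)%N -> phi_alpha w (j + k%:Z) = phi_alpha w' (j + k%:Z)) ->
  `|(o j).1.1 - (o' j).1.1| <= kappa ^+ n.
Proof.
move=> co co'; elim: n j => [|n IH] j ww.
  have /box3E[[u0 u1 _] _] := coded_by01 j co; have /box3E[[u0' u1' _] _] := coded_by01 j co'.
  by rewrite expr0 ler_norml; apply/andP; split; lra.
have {}IH : `|(o (j + 1)).1.1 - (o' (j + 1)).1.1| <= kappa ^+ n.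
  by apply: IH => k kn; rewrite -addrA -intS ww.
have [_ oE] := co j; have [_ oE'] := co' j; have := ww 0%N isT; rewrite addr0 /phi_alpha.
rewrite oE oE' in IH; move: IH; case: (w j) => i; case: (w' j) => i' //= IH.
  case=> ii; move: IH; rewrite -ii -mulrBl opprB addrA subrK normrM normfV (gtr0_norm a_gt0).
  rewrite ler_pdivrMr // => /le_trans; apply; rewrite exprSr.
  by rewrite ler_wpM2l ?exprn_ge0.
move=> _; move: IH; have sa : 0 < 1 - M%:R * a by rewrite subr_gt0.
rewrite -mulrBl opprB addrA subrK normrM normfV (gtr0_norm sa).
rewrite ler_pdivrMr // => /le_trans; apply; rewrite exprSr.
by rewrite ler_wpM2l ?exprn_ge0.
Qed.

(** Agreement of the full letters is asked here, as the offset in the stable direction depends on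
    the index of the beta. *)
Lemma stable_contraction w w' o o' j (n : nat) : coded_by a b w o -> coded_by a b w' o' ->
  (forall k, (k < n)%N -> w (j + k%:Z) = w' (j + k%:Z)) ->
  `|(o (j + n%:Z)).2 - (o' (j + n%:Z)).2| <= kappa ^+ n.
Proof.
move=> co co'; elim: n => [|n IH] ww.
  rewrite addr0; have /box3E[_ [_ u0 u1]] := coded_by01 j co; have /box3E[_ [_ u0' u1']] := coded_by01 j co'.
  by rewrite expr0 ler_norml; apply/andP; split; lra.
have {}IH := IH (fun k kn => ww k (ltnW kn)).
have [_ oE] := co (j + n%:Z); have [_ oE'] := co' (j + n%:Z).
rewrite -addn1 PoszD addrA oE oE' addn1 ww //; case: (w' (j + n%:Z)) => i /=.
  have sb : 0 < 1 - M%:R * b by rewrite subr_gt0.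
  by rewrite -mulrBr normrM (gtr0_norm sb) exprS ler_pM // ltW.
rewrite (_ : _ - _ = b * ((o (j + n%:Z)).2 - (o' (j + n%:Z)).2)); last by ring.
by rewrite normrM (gtr0_norm b_gt0) exprS ler_pM // ltW.
Qed.

(* Height 2n at time 0 leaves positive height at each of the last n times, so every beta there
   is popped from a stack determined by the window. *)
Lemma alpha_code_contraction w w' o o' (m n : nat) : (0 < n)%N ->
  coded_by a b w o -> coded_by a b w' o' ->
  (n.*2)%:Z <= height (phi_alpha w) (- m%:Z) m ->
  (forall k, (k < m + n)%N -> phi_alpha w (- m%:Z + k%:Z) = phi_alpha w' (- m%:Z + k%:Z)) ->
  [/\ `|(o 0).1.1 - (o' 0).1.1| <= kappa ^+ n, `|(o 0).1.2 - (o' 0).1.2| <= kappa ^+ n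
    & `|(o 0).2 - (o' 0).2| <= kappa ^+ n].
Proof.
move=> n0 co co' hm ww.
have mn : (n.*2 <= m)%N.
  by have := le_trans hm (le_trans (ler_norm _) (height_bound _ _ _)); rewrite lez_nat.
have kappa1 : M%:R^-1 <= 1 :> R by rewrite invf_le1 ?Mreal_gt0 // ler1n M_gt0.
have st k : (k <= m)%N -> stack (phi_alpha w) (- m%:Z) k = stack (phi_alpha w') (- m%:Z) k.
  by move=> km; apply: eq_stack => l lk; apply: ww; move: lk km; clear; lia.
split.
- apply: unstable_contraction co co' _ => k kn; rewrite add0r.
  by have := ww (m + k)%N; rewrite PoszD addKr; apply; move: kn; clear; lia.
- have [y y01 cE] := coded_by_stack (- m%:Z) m co.
  have [y' y01' cE'] := coded_by_stack (- m%:Z) m co'.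
  rewrite addNr -?st // in cE cE'; rewrite cE cE'.
  apply: le_trans (foldr_push_dist _ y01 y01') _.
  have sz : (n <= size (stack (phi_alpha w) (- m%:Z) m))%N.
    rewrite -lez_nat; apply: le_trans (height_le_stack _ _ _); apply: le_trans hm.
    by rewrite lez_nat -addnn leq_addr.
  apply: (@le_trans _ _ (M%:R^-1 ^+ n)); first by rewrite ler_wiXn2l ?invr_ge0.
  by rewrite lerXn2r ?nnegrE ?invr_ge0.
- have := @stable_contraction w w' o o' (- n%:Z) n co co'; rewrite addNr; apply=> k kn.
  have mk : - n%:Z + k%:Z = - m%:Z + (m - n + k)%:Z by move: mn kn; clear; lia.
  rewrite mk; have := ww (m - n + k)%N; rewrite /phi_alpha => /(_ ltac:(move: mn kn; clear; lia)).
  case wk : (w _) => [i|i]; case wk' : (w' _) => [i'|i'] //; [by case=> ->|move=> _].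
  have nonempty : (0 < size (stack (phi_alpha w) (- m%:Z) (m - n + k)))%N.
    have := height_split (phi_alpha w) (- m%:Z) (m - n + k) (n - k).
    have := height_bound (phi_alpha w) (- m%:Z + (m - n + k)%:Z) (n - k).
    have := height_le_stack (phi_alpha w) (- m%:Z) (m - n + k).
    rewrite (_ : m - n + k + (n - k) = m)%N; last by move: mn kn; clear; lia.
    move: (height _ _ m) (height _ _ (m - n + k)) (height _ _ (n - k)) (size _) hm n0.
    by move=> h1 h2 h3 z; clear; lia.
  case s1 : (stack (phi_alpha w) _ _) nonempty => [|l s] //= _.
  have stE : stack (phi_alpha w') (- m%:Z) (m - n + k) = l :: s.
    by rewrite -s1 st //; move: mn kn; clear; lia.
  by rewrite -(coded_by_pop co s1 wk) -(coded_by_pop co' stE wk').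
Qed.
End Contraction.
End Orbits.

(** * Lebesgue measure on the cube *)

Section Leb3.
Variable R : realType.
Local Notation leb := (@lebesgue_measure R).

Local Notation mR := (measurableTypeR R).
(* [pt R] with the copy of the Borel sigma-algebra on which [lebesgue_measure] is declared;
   the measurable sets are convertible to those of [pt R]. *)
Definition mpt : Type := (mR * mR * mR)%type.
HB.instance Definition _ := Measurable.on mpt.

Definition leb3 : {measure set mpt -> \bar R} := ((leb \x leb) \x leb)%E.

Lemma Leb3E : @Leb3 R = leb3. Proof. by []. Qed.

Lemma leb3_box (A B C : set mR) : measurable A -> measurable B -> measurable C ->
  leb3 ((A `*` B) `*` C) = (leb A * leb B * leb C)%E.
Proof.
move=> mA mB mC; rewrite /leb3 /= product_measure1E //=; last exact: measurableX.
by rewrite product_measure1E.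
Qed.

Definition boxes : set (set mpt) := [set E | exists A B C : set mR,
  [/\ measurable A, measurable B, measurable C & E = (A `*` B) `*` C]].

(** The identity from the sigma-algebra generated by boxes to the product one is measurable because
    its coordinates are; this is the nontrivial inclusion. *)
Lemma measurable_boxes : (measurable : set (set mpt)) = <<s boxes >>.
Proof.
apply/seteqP; split; last first.
  apply: smallest_sub; first exact: sigma_algebra_measurable.
  by move=> _ [A [B [C [mA mB mC ->]]]]; apply: measurableX => //; exact: measurableX.
pose T := g_sigma_algebraType boxes.
have : measurable_fun [set: T] (fun x : T => (x : mpt)).
  have box A B C : measurable A -> measurable B -> measurable C -> 
    (measurable : set (set T)) ((A `*` B) `*` C).
    by move=> mA mB mC; apply: sub_sigma_algebra; exists A, B, C.
  apply/prod_measurable_funP; split.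
    apply/prod_measurable_funP; split => _ Y mY; rewrite setTI.
      rewrite (_ : _ @^-1` _ = (Y `*` setT) `*` setT); first exact: box.
      by apply/seteqP; split=> x //= -[[]].
    rewrite (_ : _ @^-1` _ = (setT `*` Y) `*` setT); first exact: box.
    by apply/seteqP; split=> x //= -[[]].
  move=> _ Y mY; rewrite setTI.
  rewrite (_ : _ @^-1` _ = (setT `*` setT) `*` Y); first exact: box.
  by apply/seteqP; split=> x //= -[[]].
by move=> mid E mE; have := mid measurableT E mE; rewrite setTI.
Qed.

(** Boxes are stable under intersection and generate, and the cubes with sides [[-n, n]] exhaust the
    space with finite measure. *)
Lemma leb3_unique (m : {measure set mpt -> \bar R}) :
  (forall A B C : set mR, measurable A -> measurable B -> measurable C ->
    m ((A `*` B) `*` C) = (leb A * leb B * leb C)%E) ->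
  forall E, measurable E -> leb3 E = m E.
Proof.
move=> mE; pose I n : set mR := `[- n%:R, n%:R]%classic.
have mI n : measurable (I n) by exact: (@measurable_itv R).
apply: (measure_unique boxes (fun n => (I n `*` I n) `*` I n)).
- exact: measurable_boxes.
- move=> _ _ [A [B [C [mA mB mC ->]]]] [A' [B' [C' [mA' mB' mC' ->]]]].
  exists (A `&` A'), (B `&` B'), (C `&` C'); split; try exact: measurableI.
  by apply/seteqP; split => x /=; tauto.
- by move=> n; exists (I n), (I n), (I n).
- apply/seteqP; split => // -[[u c] s] _.
  exists (Num.bound (`|u| + `|c| + `|s|)) => //=.
  rewrite /I /= !in_itv /=; have := archi_boundP (addr_ge0 (addr_ge0 (normr_ge0 u) (normr_ge0 c)) (normr_ge0 s)).
  move: (_%:R) => n; have := (ler_norm u, ler_norm (- u), ler_norm c, ler_norm (- c), ler_norm s, ler_norm (- s)).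
  rewrite !normrN => -[[[[[? ?] ?] ?] ?] ?] ?.
  have := (normr_ge0 u, normr_ge0 c, normr_ge0 s) => -[[? ?] ?].
  by split; first split; apply/andP; split; lra.
- by move=> _ [A [B [C [mA mB mC ->]]]]; rewrite mE // leb3_box.
- move=> n; have fin : (leb (I n) < +oo)%E by rewrite /I lebesgue_measure_itv /=; case: ifP => _; rewrite ?ltry // -EFinB ltry.
  by rewrite leb3_box // !lte_mul_pinfty ?mule_ge0 // ge0_fin_numE ?mule_ge0 // lte_mul_pinfty // ge0_fin_numE.
Qed.

Lemma leb3_preserved (f : mpt -> mpt) : measurable_fun setT f ->
  (forall A B C : set mR, measurable A -> measurable B -> measurable C ->
    leb3 (f @^-1` ((A `*` B) `*` C)) = (leb A * leb B * leb C)%E) ->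
  forall E, measurable E -> leb3 (f @^-1` E) = leb3 E.
Proof.
by move=> mf fE E mE; rewrite [RHS](@leb3_unique (pushforward leb3 f)).
Qed.

Lemma leb_scaled (f : mR -> mR) (k : {nonneg R}) : measurable_fun setT f ->
  (forall x y : R, x <= y -> (k%:num%:E * leb (f @^-1` `]x, y]%classic) = (y - x)%:E)%E) ->
  forall X : set mR, measurable X -> (k%:num%:E * leb (f @^-1` X) = leb X)%E.
Proof.
move=> mf fE X mX; rewrite [RHS](@lebesgue_measure_unique _ (mscale k (pushforward leb f))) //.
move=> _ [[x y] _ <-] /=; rewrite /mscale /pushforward /=; have [xy|yx] := leP x y.
  rewrite fE // lebesgue_measure_itv /= lte_fin.
  by move: xy; rewrite le_eqVlt => /predU1P[->|xy]; [rewrite ltxx subrr|rewrite xy -EFinB].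
by rewrite set_itv_ge ?preimage_set0 ?measure0 ?mule0 // -leNgt bnd_simp ltW.
Qed.

Definition affine (k d : R) (x : mR) : mR := k * x + d.

Lemma measurable_affine (k d : R) : measurable_fun (setT : set mR) (affine k d).
Proof.
have : measurable_fun (setT : set R) (fun x : R => k * x + d).
  by apply: measurable_realfun.measurable_funD => //; apply: measurable_realfun.measurable_funM.
by [].
Qed.

Lemma leb_affine (k d : R) (X : set mR) : 0 < k -> measurable X ->
  (k%:E * leb ((affine k d) @^-1` X) = leb X)%E.
Proof.
move=> k0; have k0' := ltW k0.
apply: (@leb_scaled _ (NngNum k0')); first exact: measurable_affine.
move=> x y xy; rewrite (_ : _ @^-1` _ = `](x - d) / k, (y - d) / k]%classic); last first.
  by apply/seteqP; split => z; rewrite /affine /= !in_itv /= ltr_pdivrMr // ler_pdivlMr // ltrBlDr lerBrDr mulrC.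
rewrite lebesgue_measure_itv /= lte_fin ltr_pM2r ?invr_gt0 // ltrD2r.
move: xy; rewrite le_eqVlt => /predU1P[->|xy]; first by rewrite ltxx mule0 subrr.
rewrite xy -EFinB -EFinM; congr (_%:E); rewrite -mulrBl opprB addrA subrK mulrC divfK //; exact: lt0r_neq0.
Qed.

Lemma leb_reflection (X : set mR) : measurable X ->
  leb ((affine (-1) 1) @^-1` X) = leb X.
Proof.
move=> mX; rewrite -[RHS](@leb_scaled (affine (-1) 1) (NngNum ler01)) ?mul1e //.
  exact: measurable_affine.
(* The negative slope moves the closed end of the interval to the left. *)
move=> x y xy; rewrite mul1e (_ : _ @^-1` _ = `[1 - y, 1 - x[%classic); last first.
  apply/seteqP; split => z; rewrite /affine /= !in_itv /= => /andP[? ?]; apply/andP; split; lra.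
rewrite lebesgue_measure_itv /= lte_fin ltrD2l ltrN2.
move: xy; rewrite le_eqVlt => /predU1P[->|xy]; first by rewrite ltxx subrr.
rewrite xy -EFinB; congr (_%:E); ring.
Qed.

Definition diagonal_affine (k1 d1 k2 d2 k3 d3 : R) (p : mpt) : mpt :=
  ((k1 * p.1.1 + d1, k2 * p.1.2 + d2), k3 * p.2 + d3).

Lemma measurable_coord1 : measurable_fun setT (fun p : mpt => p.1.1).
Proof. exact: measurableT_comp measurable_fst measurable_fst. Qed.

Lemma measurable_coord2 : measurable_fun setT (fun p : mpt => p.1.2).
Proof. exact: measurableT_comp measurable_snd measurable_fst. Qed.

Lemma measurable_diagonal_affine k1 d1 k2 d2 k3 d3 :
  measurable_fun setT (diagonal_affine k1 d1 k2 d2 k3 d3).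
Proof.
apply: measurable_fun_pair; first apply: measurable_fun_pair.
- exact: measurableT_comp (measurable_affine k1 d1) measurable_coord1.
- exact: measurableT_comp (measurable_affine k2 d2) measurable_coord2.
- exact: measurableT_comp (measurable_affine k3 d3) measurable_snd.
Qed.

Lemma leb3_diagonal_affine k1 d1 k2 d2 k3 d3 : 0 < k1 -> 0 < k2 -> 0 < k3 ->
  k1 * k2 * k3 = 1 -> forall E, measurable E ->
  leb3 (diagonal_affine k1 d1 k2 d2 k3 d3 @^-1` E) = leb3 E.
Proof.
move=> k10 k20 k30 kkk; apply: leb3_preserved; first exact: measurable_diagonal_affine.
move=> A B C mA mB mC; rewrite -(leb_affine d1 k10 mA) -(leb_affine d2 k20 mB) -(leb_affine d3 k30 mC).
have pm k d X : measurable X -> measurable ((affine k d) @^-1` X).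
  by move=> mX; rewrite -[X in measurable X]setTI; apply: measurable_affine.
rewrite (muleACA k1%:E _ k2%:E) (muleACA (k1%:E * k2%:E)%E _ k3%:E) -!EFinM kkk mul1e -leb3_box; [|exact: pm..].
by congr (leb3 _); apply/seteqP; split.
Qed.

(** Written [-1 * x + 1] so that every coordinate is an instance of [affine]. *)
Definition reflection (p : mpt) : mpt := ((-1 * p.2 + 1, -1 * p.1.2 + 1), -1 * p.1.1 + 1).

Lemma measurable_reflection : measurable_fun setT reflection.
Proof.
apply: measurable_fun_pair; first apply: measurable_fun_pair.
- exact: measurableT_comp (measurable_affine _ _) measurable_snd.
- exact: measurableT_comp (measurable_affine _ _) measurable_coord2.
- exact: measurableT_comp (measurable_affine _ _) measurable_coord1.
Qed.

Lemma leb3_reflection E : measurable E -> leb3 (reflection @^-1` E) = leb3 E.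
Proof.
apply: leb3_preserved; first exact: measurable_reflection.
move=> A B C mA mB mC; rewrite -(leb_reflection mA) -(leb_reflection mB) -(leb_reflection mC).
have pm X : measurable X -> measurable ((affine (-1) 1) @^-1` X).
  by move=> mX; rewrite -[X in measurable X]setTI; apply: measurable_affine.
rewrite [RHS]muleC [X in (_ * X)%E]muleC muleA -leb3_box; [|exact: pm..].
congr (leb3 _); apply/seteqP; split => p /=; tauto.
Qed.

Lemma box3_leb3 (x1 y1 x2 y2 x3 y3 : R) : x1 <= y1 -> x2 <= y2 -> x3 <= y3 ->
  leb3 (box3 x1 y1 x2 y2 x3 y3) = ((y1 - x1) * (y2 - x2) * (y3 - x3))%:E.
Proof.
move=> h1 h2 h3; rewrite /box3 leb3_box; try exact: (@measurable_itv R).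
have itv (x y : R) : x <= y -> leb `]x, y[%classic = (y - x)%:E.
  rewrite lebesgue_measure_itv /= lte_fin le_eqVlt => /orP[/eqP ->|xy].
    by rewrite ltxx subrr.
  by rewrite xy -EFinB.
by rewrite !itv.
Qed.

Lemma measurable_box3 (x1 y1 x2 y2 x3 y3 : R) : measurable (box3 x1 y1 x2 y2 x3 y3 : set mpt).
Proof.
by apply: measurableX; first apply: measurableX; exact: (@measurable_itv R).
Qed.

End Leb3.

(** * Almost every point is coded *)

Section OuterBound.
Variable R : realType.
Local Notation mpt := (mpt R).
Local Open Scope ereal_scope.

(** An outer Lebesgue bound through a measurable hull, for sets defined by codes whose measurability
    is not established. *)
Definition leb_le (X : set mpt) (r : \bar R) :=
  exists B : set mpt, [/\ measurable B, X `<=` B & leb3 R B <= r].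

Lemma leb_leS X Y r s : X `<=` Y -> r <= s -> leb_le Y r -> leb_le X s.
Proof.
move=> XY rs [B [mB YB Br]]; exists B; split => //; [exact: subset_trans YB|exact: le_trans rs].
Qed.

Lemma leb_le_measurable E r : measurable E -> leb_le E r -> leb3 R E <= r.
Proof. by move=> mE [B [mB EB]]; apply: le_trans; apply: le_measure; rewrite ?inE. Qed.

Lemma leb_le_bigcup (X : nat -> set mpt) (r : nat -> \bar R) :
  (forall n, leb_le (X n) (r n)) -> leb_le (\bigcup_n X n) (\sum_(0 <= n <oo) r n).
Proof.
move=> /choice[B BP]; exists (\bigcup_n B n); split.
- by apply: bigcupT_measurable => n; have [] := BP n.
- by move=> x [n _ xn]; exists n => //; have [_ + _] := BP n; apply.
- apply: le_trans (measure_sigma_subadditive (leb3 R) _ _ (@subset_refl _ _)) _.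
  + by move=> n; have [] := BP n.
  + by apply: bigcupT_measurable => n; have [] := BP n.
  + by apply: lee_nneseries => // n _; have [] := BP n.
Qed.

Lemma leb_leU X Y r s : leb_le X r -> leb_le Y s -> leb_le (X `|` Y) (r + s).
Proof.
move=> [B [mB XB Br]] [C [mC YC Cs]]; exists (B `|` C); split.
- exact: measurableU.
- exact: setUSS.
- exact: le_trans (measureU2 (leb3 R) mB mC) (leeD Br Cs).
Qed.

Section Pieces.
Variable I : finType.
Variables (P Q : I -> set mpt) (f : I -> mpt -> mpt).
Hypothesis measP : forall i, measurable (P i).
Hypothesis measQ : forall i, measurable (Q i).
Hypothesis measf : forall i, measurable_fun setT (f i).
Hypothesis disjP : trivIset setT P.
Hypothesis disjQ : trivIset setT Q.

Lemma leb3_bigcup (F : I -> set mpt) : (forall i, measurable (F i)) -> trivIset setT F ->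
  leb3 R (\bigcup_i F i) = \sum_i leb3 R (F i).
Proof.
move=> mF tF; rewrite measure_fin_bigcup //; last exact: finite_finset.
rewrite (fsbigE (index_enum I)) ?index_enum_uniq //.
  by apply: eq_bigl => i; rewrite in_setT.
by move=> i _; rewrite mem_index_enum.
Qed.

(** [P i] is the full preimage of [Q i], so each piece of the preimage of the hull [B] has the
    measure of [Q i] intersected with [B]; as the [Q i] are disjoint, these add up to at most that
    of [B]. *)
Lemma leb_le_pieces X r : (forall i E, measurable E -> leb3 R (f i @^-1` E) = leb3 R E) ->
  (forall i x, P i x -> Q i (f i x)) -> (forall i x, Q i (f i x) -> P i x) ->
  leb_le X r -> leb_le [set x | exists i, P i x /\ X (f i x)] r.
Proof.
move=> pf PQ QP [B [mB XB Br]].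
have mfi i E : measurable E -> measurable (f i @^-1` E).
  by move=> mE; rewrite -[X in measurable X]setTI; exact: measf.
have FE i : P i `&` f i @^-1` B = f i @^-1` (Q i `&` B).
  by apply/seteqP; split=> x [/= ? ?]; split=> //; [exact: PQ|exact: QP].
exists (\bigcup_i (P i `&` f i @^-1` B)); split.
- by apply: fin_bigcup_measurable; [exact: finite_finset | move=> i _; apply: measurableI => //; exact: mfi].
- by move=> x [i [Px Xx]]; exists i => //; split => //; exact: XB.
- have eqPQ i : leb3 R (P i `&` f i @^-1` B) = leb3 R (Q i `&` B).
    by rewrite FE pf //; exact: measurableI.
  rewrite leb3_bigcup; last exact: trivIset_setIr.
    rewrite (eq_bigr _ (fun i _ => eqPQ i)) -(leb3_bigcup (F := fun i => Q i `&` B)).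
    + apply: le_trans Br; apply: le_measure; rewrite ?inE //.
      * by apply: fin_bigcup_measurable; [exact: finite_finset | move=> i _; apply: measurableI].
      * by move=> x [i _ []].
    + by move=> i; exact: measurableI.
    + exact: trivIset_setIr.
  by move=> i; apply: measurableI => //; exact: mfi.
Qed.

Lemma leb_le_full C : measurable C -> leb3 R C = 1 -> \sum_i leb3 R (P i) = 1 ->
  (forall i, P i `<=` C) -> leb_le (C `\` \bigcup_i P i) 0.
Proof.
move=> mC C1 P1 PC.
have mU : measurable (\bigcup_i P i) by apply: fin_bigcup_measurable; [exact: finite_finset|].
exists (C `\` \bigcup_i P i); split => //; first exact: measurableD.
have fC : leb3 R C < +oo by rewrite C1 ltry.
have U1 : leb3 R (\bigcup_i P i) = 1 by rewrite leb3_bigcup.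
rewrite measureD // (_ : C `&` _ = \bigcup_i P i); last first.
  by apply/seteqP; split => [x []//|x [i _ Px]]; split; [exact: PC Px|exists i].
by rewrite -[X in X - _]/(leb3 R C) -[X in _ - X]/(leb3 R (\bigcup_i P i)) U1 C1 subee.
Qed.

End Pieces.
End OuterBound.

Section Dynamics.
Variables (R : realType) (M : nat) (a b : R).
Hypothesis M_gt1 : (2 <= M)%N.
Hypotheses (a_gt0 : 0 < a) (Ma_lt1 : M%:R * a < 1).
Hypotheses (b_gt0 : 0 < b) (Mb_lt1 : M%:R * b < 1).
(** The Jacobians of the branches are [(1 - M b) / (M a)] and [M b / (1 - M a)]; both equal 1
    exactly under this equation. *)
Hypothesis volume : M%:R * a + M%:R * b = 1.
Local Notation mpt := (mpt R).
Local Notation lam := (@bernoulli_unif R (option 'I_M)).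

Implicit Types (w : int -> Dsym M) (o : int -> mpt) (X Y : set mpt) (j : int) (n : nat).

Local Lemma natM_gt0 : (0 < M)%N. Proof. exact: ltnW. Qed.
Local Lemma realM_gt0 : 0 < M%:R :> R. Proof. by rewrite ltr0n natM_gt0. Qed.

(** Indexing the letters by a finite type gives finite sums of measures over them. *)
Definition dsym (i : 'I_M + 'I_M) : Dsym M :=
  match i with inl i => Alpha i | inr i => Beta i end.

Lemma dsym_surj g : exists i, dsym i = g.
Proof. by case: g => i; [exists (inl i)|exists (inr i)]. Qed.

Lemma dsym_inj : injective dsym.
Proof. by case=> i [] j //= [->]. Qed.

Definition ocell (i : 'I_M + 'I_M) : set mpt := obox a (dsym i).
Definition vcell (i : 'I_M + 'I_M) : set mpt := vbox b (dsym i).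

Lemma measurable_ocell i : measurable (ocell i).
Proof. by case: i => i; exact: measurable_box3. Qed.

Lemma measurable_vcell i : measurable (vcell i).
Proof. by case: i => i; exact: measurable_box3. Qed.

Lemma trivIset_ocell : trivIset setT ocell.
Proof.
move=> i j _ _ [x [xi xj]]; apply: dsym_inj.
exact: (obox_inj natM_gt0 a_gt0 Ma_lt1 xi xj).
Qed.

Lemma trivIset_vcell : trivIset setT vcell.
Proof.
move=> i j _ _ [x [xi xj]]; apply: dsym_inj.
exact: (vbox_inj natM_gt0 b_gt0 Mb_lt1 xi xj).
Qed.

Definition fcell (i : 'I_M + 'I_M) : mpt -> mpt := fpiece a b (dsym i).
Definition gcell (i : 'I_M + 'I_M) : mpt -> mpt := fpiece_inv a b (dsym i).

Lemma affine_cells i : exists k : R * R * R * R * R * R,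
  let: (k1, d1, k2, d2, k3, d3) := k in
  [/\ 0 < k1, 0 < k2, 0 < k3, k1 * k2 * k3 = 1 & fcell i = diagonal_affine k1 d1 k2 d2 k3 d3].
Proof.
have [ha hb hM] := And3 a_gt0 b_gt0 realM_gt0.
have sa : 0 < 1 - M%:R * a by rewrite subr_gt0.
have sb : 0 < 1 - M%:R * b by rewrite subr_gt0.
have saE : 1 - M%:R * a = M%:R * b by have v := volume; lra.
have sbE : 1 - M%:R * b = M%:R * a by have v := volume; lra.
case: i => i.
  exists (a^-1, - i%:R, M%:R^-1, i%:R / M%:R, 1 - M%:R * b, 0).
  rewrite !invr_gt0; split => //; first by rewrite sbE; field; rewrite !lt0r_neq0.
  by apply/funext => -[[u c] s]; congr ((_, _), _) => /=; field; rewrite ?lt0r_neq0.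
exists ((1 - M%:R * a)^-1, - (M%:R * a) / (1 - M%:R * a), M%:R, - i%:R, b,
  1 + b * (i.+1%:R - M%:R - 1)).
rewrite !invr_gt0; split => //; first by rewrite saE; field; rewrite !lt0r_neq0.
by apply/funext => -[[u c] s]; congr ((_, _), _) => /=; field; rewrite ?lt0r_neq0.
Qed.

Lemma affine_inverse_cells i : exists k : R * R * R * R * R * R,
  let: (k1, d1, k2, d2, k3, d3) := k in
  [/\ 0 < k1, 0 < k2, 0 < k3, k1 * k2 * k3 = 1 & gcell i = diagonal_affine k1 d1 k2 d2 k3 d3].
Proof.
have [ha hb hM] := And3 a_gt0 b_gt0 realM_gt0.
have sa : 0 < 1 - M%:R * a by rewrite subr_gt0.
have sb : 0 < 1 - M%:R * b by rewrite subr_gt0.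
have saE : 1 - M%:R * a = M%:R * b by have v := volume; lra.
have sbE : 1 - M%:R * b = M%:R * a by have v := volume; lra.
case: i => i.
  exists (a, i%:R * a, M%:R, - i%:R, (1 - M%:R * b)^-1, 0).
  rewrite !invr_gt0; split => //; first by rewrite sbE; field; rewrite !lt0r_neq0.
  by apply/funext => -[[u c] s]; congr ((_, _), _) => /=; field; rewrite ?lt0r_neq0.
exists (1 - M%:R * a, M%:R * a, M%:R^-1, i%:R / M%:R, b^-1,
  - (1 - M%:R * b + i%:R * b) / b).
rewrite !invr_gt0; split => //; first by rewrite saE; field; rewrite !lt0r_neq0.
by apply/funext => -[[u c] s]; congr ((_, _), _) => /=; field; rewrite ?lt0r_neq0.
Qed.

Definition preimg (X : set mpt) : set mpt := [set x | exists i, ocell i x /\ X (fcell i x)].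
Definition img (X : set mpt) : set mpt := [set x | exists i, vcell i x /\ X (gcell i x)].

Lemma leb_le_preimg X r : leb_le X r -> leb_le (preimg X) r.
Proof.
apply: (leb_le_pieces measurable_ocell measurable_vcell _ trivIset_ocell trivIset_vcell).
- move=> i; have [[[[[[k1 d1] k2] d2] k3] d3] [_ _ _ _ ->]] := affine_cells i.
  exact: measurable_diagonal_affine.
- move=> i; have [[[[[[k1 d1] k2] d2] k3] d3] [p1 p2 p3 k ->]] := affine_cells i.
  exact: leb3_diagonal_affine.
- by move=> i x; apply: vbox_fpiece => //; exact: natM_gt0.
- move=> i x /(obox_fpiece_inv natM_gt0 a_gt0 Ma_lt1 b_gt0 Mb_lt1).
  by rewrite fpieceK //; exact: natM_gt0.
Qed.

Lemma leb_le_img X r : leb_le X r -> leb_le (img X) r.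
Proof.
apply: (leb_le_pieces measurable_vcell measurable_ocell _ trivIset_vcell trivIset_ocell).
- move=> i; have [[[[[[k1 d1] k2] d2] k3] d3] [_ _ _ _ ->]] := affine_inverse_cells i.
  exact: measurable_diagonal_affine.
- move=> i; have [[[[[[k1 d1] k2] d2] k3] d3] [p1 p2 p3 k ->]] := affine_inverse_cells i.
  exact: leb3_diagonal_affine.
- by move=> i x; apply: obox_fpiece_inv => //; exact: natM_gt0.
- move=> i x /(vbox_fpiece natM_gt0 a_gt0 Ma_lt1 b_gt0 Mb_lt1).
  by rewrite fpiece_invK //; exact: natM_gt0.
Qed.

Lemma leb_le_iter (F : set mpt -> set mpt) X r n :
  (forall Y, leb_le Y r -> leb_le (F Y) r) -> leb_le X r -> leb_le (iter n F X) r.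
Proof. by move=> FF X0; elim: n => //= n; exact: FF. Qed.

Definition cube : set mpt :=
  (`[0, 1]%classic `*` `[0, 1]%classic) `*` `[0, 1]%classic.

Lemma measurable_cube : measurable cube.
Proof. by apply: measurableX; first apply: measurableX; exact: (@measurable_itv R). Qed.

Lemma leb3_cube : leb3 R cube = 1%E.
Proof.
rewrite leb3_box; try exact: (@measurable_itv R).
by rewrite lebesgue_measure_itv /= lte_fin ltr01 -EFinB subr0 !mul1e.
Qed.

Lemma open_cube : box3 0 1 0 1 0 1 `<=` cube.
Proof.
move=> p /box3E[[u0 u1 c0] [c1 s0 s1]]; rewrite /cube /= !in_itv /=.
by rewrite (ltW u0) (ltW u1) (ltW c0) (ltW c1) (ltW s0) (ltW s1).
Qed.

Lemma leb_le_ocells : leb_le (cube `\` \bigcup_i ocell i) 0%E.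
Proof.
have [ha hb hM] := And3 a_gt0 b_gt0 realM_gt0.
apply: leb_le_full => //.
- exact: measurable_ocell.
- exact: trivIset_ocell.
- exact: measurable_cube.
- exact: leb3_cube.
- rewrite big_sumType /=.
  have -> : (\sum_(i < M) leb3 R (ocell (inl i)) = (M%:R * a)%:E)%E.
    rewrite (eq_bigr (fun=> a%:E)) => [|i _]; first by rewrite sumEFin sumr_const card_ord mulr_natl.
    rewrite box3_leb3 //; last by rewrite ler_pM2r // ler_nat.
    by rewrite -natr1; congr (_%:E); ring.
  have -> : (\sum_(i < M) leb3 R (ocell (inr i)) = (1 - M%:R * a)%:E)%E.
    rewrite (eq_bigr (fun=> ((1 - M%:R * a) / M%:R)%:E)) => [|i _].
      by rewrite sumEFin sumr_const card_ord -[(_ / _) *+ _]mulr_natl mulrC divfK // lt0r_neq0.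
    rewrite box3_leb3 //; [|exact: ltW|by rewrite ler_pM2r ?invr_gt0 // ler_nat].
    by rewrite -natr1; congr (_%:E); field; rewrite lt0r_neq0.
  by rewrite -EFinD addrC subrK.
- by move=> i x /(obox_cube natM_gt0 a_gt0 Ma_lt1); exact: open_cube.
Qed.

Lemma leb_le_vcells : leb_le (cube `\` \bigcup_i vcell i) 0%E.
Proof.
have [ha hb hM] := And3 a_gt0 b_gt0 realM_gt0.
apply: leb_le_full => //.
- exact: measurable_vcell.
- exact: trivIset_vcell.
- exact: measurable_cube.
- exact: leb3_cube.
- rewrite big_sumType /=.
  have -> : (\sum_(i < M) leb3 R (vcell (inl i)) = (1 - M%:R * b)%:E)%E.
    rewrite (eq_bigr (fun=> ((1 - M%:R * b) / M%:R)%:E)) => [|i _].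
      by rewrite sumEFin sumr_const card_ord -[(_ / _) *+ _]mulr_natl mulrC divfK // lt0r_neq0.
    rewrite box3_leb3 //; [|by rewrite ler_pM2r ?invr_gt0 // ler_nat|by rewrite subr_ge0 ltW].
    by rewrite -natr1; congr (_%:E); field; rewrite lt0r_neq0.
  have -> : (\sum_(i < M) leb3 R (vcell (inr i)) = (M%:R * b)%:E)%E.
    rewrite (eq_bigr (fun=> b%:E)) => [|i _]; first by rewrite sumEFin sumr_const card_ord mulr_natl.
    rewrite box3_leb3 //; last by rewrite lerD2l ler_pM2r // ler_nat.
    by rewrite -natr1; congr (_%:E); ring.
  by rewrite -EFinD subrK.
- by move=> i x /(vbox_cube natM_gt0 b_gt0 Mb_lt1); exact: open_cube.
Qed.

(** The points whose forward orbit never leaves the open boxes; the excluded set is a countable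
    union of preimages of a null set. *)
Definition forward_good : set mpt :=
  [set x | cube x /\ forall n, ~ iter n preimg (cube `\` \bigcup_i ocell i) x].
Definition backward_good : set mpt :=
  [set x | cube x /\ forall n, ~ iter n img (cube `\` \bigcup_i vcell i) x].

Lemma forward_goodP (x : mpt) : forward_good x ->
  exists i, ocell i x /\ forward_good (fcell i x).
Proof.
move=> [cx nx]; have [i _ xi] : (\bigcup_i ocell i) x.
  by apply: contrapT => xn; apply: (nx 0%N).
exists i; split => //; split.
  by apply: open_cube; apply: (vbox_cube natM_gt0 b_gt0 Mb_lt1); apply: vbox_fpiece (xi); rewrite ?natM_gt0.
by move=> n fn; apply: (nx n.+1) => /=; exists i.
Qed.

Lemma backward_goodP (x : mpt) : backward_good x ->
  exists i, vcell i x /\ backward_good (gcell i x).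
Proof.
move=> [cx nx]; have [i _ xi] : (\bigcup_i vcell i) x.
  by apply: contrapT => xn; apply: (nx 0%N).
exists i; split => //; split.
  apply: open_cube; apply: (obox_cube natM_gt0 a_gt0 Ma_lt1).
  by apply: obox_fpiece_inv (xi); rewrite ?natM_gt0.
by move=> n fn; apply: (nx n.+1) => /=; exists i.
Qed.

Lemma good_coded (x : mpt) : forward_good x -> backward_good x -> exists w, coded a b x w.
Proof.
move=> fx bx.
pose i0 : 'I_M + 'I_M := inl (Ordinal natM_gt0).
have fstep y : exists i, forward_good y -> ocell i y /\ forward_good (fcell i y).
  by have [/forward_goodP[i yi]|ny] := pselect (forward_good y); [exists i|exists i0].
have bstep y : exists i, backward_good y -> vcell i y /\ backward_good (gcell i y).
  by have [/backward_goodP[i yi]|ny] := pselect (backward_good y); [exists i|exists i0].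
have [[e eP] [d dP]] := (choice fstep, choice bstep).
pose nxt y := fcell (e y) y; pose prv y := gcell (d y) y.
have fgood n : forward_good (iter n nxt x) by elim: n => //= n /eP[].
have bgood n : backward_good (iter n prv x) by elim: n => //= n /dP[].
(* [Negz n] is the time [- (n + 1)]: its point is the backward iterate of order [n + 1], and its
   letter is that of the image box containing the iterate of order [n]. *)
pose o (n : int) := match n with Posz n => iter n nxt x | Negz n => iter n.+1 prv x end.
pose w (n : int) := dsym (match n with Posz n => e (iter n nxt x) | Negz n => d (iter n prv x) end).
exists w; exists o => //; case=> n.
  by rewrite -PoszD addn1 /=; have [] := eP _ (fgood n).
have [vn _] := dP _ (bgood n); split.
  by apply: obox_fpiece_inv vn; rewrite ?natM_gt0.
rewrite (_ : o (Negz n + 1) = iter n prv x); last first.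
  case: n {vn} => [|n]; first by [].
  by rewrite (_ : Negz n.+1 + 1 = Negz n) // !NegzE; lia.
by rewrite /= fpiece_invK // natM_gt0.
Qed.

Lemma leb_le_not_coded : leb_le (cube `\` [set x | exists w, coded a b x w]) 0%E.
Proof.
pose N := \bigcup_n iter n preimg (cube `\` \bigcup_i ocell i)
   `|` \bigcup_n iter n img (cube `\` \bigcup_i vcell i).
have N0 : leb_le N 0%E.
  rewrite -[0%E]adde0; apply: leb_leU.
    rewrite -(@eseries0 R (fun=> 0%E) 0 xpredT) //; apply: leb_le_bigcup => n.
    by apply: leb_le_iter leb_le_ocells => Y; exact: leb_le_preimg.
  rewrite -(@eseries0 R (fun=> 0%E) 0 xpredT) //; apply: leb_le_bigcup => n.
  by apply: leb_le_iter leb_le_vcells => Y; exact: leb_le_img.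
apply: leb_leS N0 => // x [cx nx]; apply: contrapT => nN; apply: nx.
by apply: good_coded; split => // n xn; apply: nN; [left|right]; exists n.
Qed.

Lemma coded_by_preimg w o j n Y : coded_by a b w o -> Y (o (j + n%:Z)) -> iter n preimg Y (o j).
Proof.
move=> co; elim: n j => [|n IH] j; first by rewrite addr0.
rewrite intS addrA => /IH{}IH /=; have [i iw] := dsym_surj (w j); have [wo oE] := co j.
by exists i; rewrite /ocell /fcell iw -oE.
Qed.

Lemma coded_by_img w o j n Y : coded_by a b w o -> Y (o j) -> iter n img Y (o (j + n%:Z)).
Proof.
move=> co Yj; elim: n => [|n IH]; first by rewrite addr0.
have [i iw] := dsym_surj (w (j + n%:Z)); have [wo oE] := co (j + n%:Z).
rewrite intS [1 + _]addrC addrA; exists i; rewrite /vcell /gcell iw oE; split.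
  by apply: vbox_fpiece => //; exact: natM_gt0.
by rewrite fpieceK // natM_gt0.
Qed.

Section UnstableWords.
(** All [M + 1] branches of [tau] then have slope [a^-1], so words of equal length have unstable
    intervals of equal length; it forces [a = M.+1%:R^-1]. *)
Hypothesis a_eq : 1 - M%:R * a = a.

Fixpoint word_start (v : seq (option 'I_M)) : R :=
  if v is s :: v' then a * word_start v' + (if s is Some i then i%:R * a else M%:R * a) else 0.

Lemma coded_by_word w o j (v : seq (option 'I_M)) : coded_by a b w o ->
  cylinder (j, v) (phi_alpha w) ->
  word_start v < (o j).1.1 < word_start v + a ^+ size v.
Proof.
move=> co; elim: v j => [|s v IH] j.
  move=> _ /=; have [oj _] := co j; have /box3E[[-> u1 _] _] := obox_cube natM_gt0 a_gt0 Ma_lt1 oj.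
  by rewrite add0r expr0.
move=> /cylinder_cons[js /IH]; have [_ ->] := co j => /=.
rewrite -js /phi_alpha; have h0 := a_gt0.
case: (w j) => i /=; rewrite ?a_eq ltr_pdivlMr // ltr_pdivrMr // exprSr mulrDl => /andP[? ?]; apply/andP; split; lra.
Qed.

(** At time [j] the point lies in a strip whose width is the mass of the word. Preimages for
    [j >= 0], and images for [j < 0], carry the bound to time 0. *)
Lemma leb_le_cylinder (c : int * seq (option 'I_M)) :
  leb_le [set x | exists2 w, coded a b x w & cylinder c (phi_alpha w)]
    (cyl_mass R c).
Proof.
case: c => j v; pose Y : set mpt := box3 (word_start v) (word_start v + a ^+ size v) 0 1 0 1.
have aE : a = M.+1%:R^-1.
  apply: (mulIf (x := M.+1%:R)); first by rewrite pnatr_eq0.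
  by rewrite mulVf ?pnatr_eq0 // -natr1 mulrDr mulr1 mulrC -{2}a_eq addrC subrK.
have Yr : leb_le Y (cyl_mass R (j, v)).
  exists Y; split => //; first exact: measurable_box3.
  rewrite box3_leb3 //; last by rewrite lerDl exprn_ge0 // ltW.
  by rewrite /cyl_mass card_letters addrAC subrr add0r subr0 !mulr1 aE exprVn.
have sub x w : coded a b x w -> cylinder (j, v) (phi_alpha w) ->
    exists2 o, o 0 = x & coded_by a b w o /\ Y (o j).
  move=> [ o ox co] cw; exists o => //; split => //.
  have /box3E[_ [c1 s0 s1]] := coded_by01 M_gt1 a_gt0 Ma_lt1 j co.
  have /box3E[[_ _ c0] _] := coded_by01 M_gt1 a_gt0 Ma_lt1 j co.
  by have /andP[lo hi] := coded_by_word co cw; apply/box3E.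
case: j => n in Yr sub *.
  apply: leb_leS (leb_le_iter n (fun Z => @leb_le_preimg Z _) Yr) => // x [w /sub cx cw].
  have [ o <- [co Yo]] := cx cw; by apply: (coded_by_preimg co); rewrite add0r.
apply: leb_leS (leb_le_iter n.+1 (fun Z => @leb_le_img Z _) Yr) => // x [w /sub cx cw].
have [ o <- [co Yo]] := cx cw.
by rewrite (_ : 0 = Negz n + n.+1%:Z); [exact: (coded_by_img _ co)|rewrite NegzE addNr].
Qed.

Lemma leb_le_codes (S : set (int -> option 'I_M)) r : (lam S < r)%E ->
  leb_le [set x | exists2 w, coded a b x w & S (phi_alpha w)] r.
Proof.
move=> /ereal_inf_lt[_ [c Sc <-] /ltW cr]; apply: leb_leS _ cr (leb_le_bigcup (fun k => leb_le_cylinder (c k))).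
by move=> x [w xw /Sc[k _ wk]]; exists k => //; exists w.
Qed.

End UnstableWords.
End Dynamics.

(** * Sufficiency *)

Section AlphaMeasure.
Variables (R : realType) (M : nat) (a b : R).
Hypothesis M_gt1 : (2 <= M)%N.
Hypotheses (a_gt0 : 0 < a) (Ma_lt1 : M%:R * a < 1).
Hypotheses (b_gt0 : 0 < b) (Mb_lt1 : M%:R * b < 1).
Hypothesis volume : M%:R * a + M%:R * b = 1.
Hypothesis a_eq : 1 - M%:R * a = a.
Local Notation lam := (@bernoulli_unif R (option 'I_M)).
Local Notation outer := (bernoulli_outer R (card_letters_gt1 M_gt1)).
Implicit Types (w : int -> Dsym M) (o : int -> pt R) (X E : set (pt R)).

(** Only drifting codes are kept: they determine their point, and the others form a null set. *)
Definition drift_codes X : set (int -> option 'I_M) :=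
  [set t | exists2 x, X x & exists2 w, coded a b x w & t = phi_alpha w /\ drifting t].

Definition drift_measure X : \bar R := lam (drift_codes X).

Lemma le_drift_codes X Y : X `<=` Y -> drift_codes X `<=` drift_codes Y.
Proof. by move=> XY t [x Xx xt]; exists x => //; exact: XY. Qed.

Lemma drift_measure0 : drift_measure set0 = 0%E.
Proof.
rewrite /drift_measure (_ : drift_codes _ = set0).
  exact: (outer_measure0 outer).
by apply/seteqP; split => // t [].
Qed.

Lemma drift_measure_ge0 X : (0 <= drift_measure X)%E.
Proof. exact: bernoulli_unif_ge0. Qed.

Lemma le_drift_measure : {homo drift_measure : X Y / X `<=` Y >-> (X <= Y)%E}.
Proof. by move=> X Y XY; apply: (le_outer_measure outer); exact: le_drift_codes. Qed.

Lemma drift_measure_sigma_subadditive : sigma_subadditive drift_measure.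
Proof.
move=> F; apply: le_trans (outer_measure_sigma_subadditive outer _).
by apply: (le_outer_measure outer) => t [x [n _ Fx] xt]; exists n => //; exists x.
Qed.

Definition drift_outer : {outer_measure set (pt R) -> \bar R} :=
  HB.pack drift_measure (isOuterMeasure.Build R (pt R) drift_measure drift_measure0
    drift_measure_ge0 le_drift_measure drift_measure_sigma_subadditive).

(** Drifting codes of points come from [B_alpha], and the remaining codes are [lam]-null. *)
Lemma mu_alphaE E : mu_alpha M a b E = drift_measure E.
Proof.
have M0 : (0 < M)%N by exact: ltnW.
rewrite /mu_alpha pi_imageE //; apply/eqP; rewrite eq_le; apply/andP; split; last first.
  apply: (le_outer_measure outer) => t [x Ex [w xw [-> dw]]]; exists w => //; split; first by exists x.
  exact: drifting_B_alpha xw dw.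
rewrite -[leRHS]adde0 -[X in (_ + X)%E](bernoulli_unif_not_drifting R M_gt1).
apply: le_trans (outer_measureU2 outer _ _).
apply: (le_outer_measure outer) => t [w [ [x Ex xw] _] <-].
have [dw|dw] := pselect (drifting (phi_alpha w)); [left|by right].
by exists x => //; exists w.
Qed.

Lemma drift_measure_le1 X : (drift_measure X <= 1)%E.
Proof.
apply: (@le_trans _ _ (lam (cylinder (0%:Z, [::])))).
  by apply: (le_outer_measure outer) => t _ k.
apply: le_trans (bernoulli_unif_cylinder R (card_letters_gt1 M_gt1) _) _.
by rewrite /cyl_mass expr0 invr1.
Qed.

(** [E] is covered by the uncoded points, which are null, the points with a code without drift,
    which cost [e / 2], and those whose code lies in [drift_codes E]. *)
Lemma leb3_le_drift_measure (E : set (mpt R)) : measurable E -> E `<=` @cube R ->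
  (leb3 R E <= drift_measure E)%E.
Proof.
move=> mE Ecube; apply/lee_addgt0Pr => e e0; apply: leb_le_measurable => //.
have e2 : 0 < e / 2 by rewrite divr_gt0.
have fin : drift_measure E \is a fin_num.
  by rewrite ge0_fin_numE ?drift_measure_ge0 // (le_lt_trans (drift_measure_le1 _)) ?ltry.
have codes S r (Sr : (lam S < r)%E) := leb_le_codes M_gt1 a_gt0 Ma_lt1 b_gt0 Mb_lt1 volume a_eq Sr.
have h1 : leb_le [set x | exists2 w, coded a b x w & drift_codes E (phi_alpha w)]
   (drift_measure E + (e / 2)%:E)%E.
  by apply: codes; rewrite -/(drift_measure E) lteDl // lte_fin.
have h2 : leb_le [set x | exists2 w, coded a b x w & (~` @drifting M) (phi_alpha w)] (e / 2)%:E.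
  by apply: codes; rewrite bernoulli_unif_not_drifting // lte_fin.
have h3 := leb_le_not_coded M_gt1 a_gt0 Ma_lt1 b_gt0 Mb_lt1 volume.
apply: leb_leS (leb_leU h3 (leb_leU h1 h2)).
  move=> x Ex; have [ [w xw]|nx] := pselect (exists w, coded a b x w); last first.
    by left; split => //; exact: Ecube.
  right; have [dw|dw] := pselect (drifting (phi_alpha w)); [left|right]; exists w => //.
  by exists x => //; exists w.
by rewrite add0e -addeA -EFinD -splitr.
Qed.

Lemma contraction_rate : exists2 kappa : R, kappa < 1 &
  [/\ 0 <= kappa, a <= kappa & 1 - M%:R * a <= kappa] /\
  [/\ b <= kappa, 1 - M%:R * b <= kappa & M%:R^-1 <= kappa].
Proof.
have M2 : 2 <= M%:R :> R by rewrite ler_nat.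
have M0 : 0 < M%:R :> R by lra.
have [ha hb v ae] := And4 a_gt0 b_gt0 volume a_eq.
have h1 : 0 <= (M%:R - 2) * a by apply: mulr_ge0; [lra|exact: ltW].
have h2 : 0 <= (M%:R - 2) * b by apply: mulr_ge0; [lra|exact: ltW].
have iM : M%:R^-1 <= 2^-1 :> R by rewrite lef_pV2 ?posrE //; lra.
(* Since [M >= 2], the value 1/2 dominates [a], [1 - M a], [b] and [1 / M]; the remaining rate
   [1 - M b] may exceed it. *)
pose k := Num.max (2^-1 : R) (1 - M%:R * b).
have k1 : 2^-1 <= k by rewrite /k le_max lexx.
have k2 : 1 - M%:R * b <= k by rewrite /k le_max lexx orbT.
exists k; first by rewrite /k gt_max; apply/andP; split; nra.
by split; split; lra.
Qed.

(** Let [Q] be the union of the cylinders all of whose drifting codes have their point in [E]. By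
    contraction a drifting code lies in [Q] exactly when its point is in [E], so the measurability
    of [Q] carries over to [E]. *)
Lemma caratheodory_open E :
  (forall x, E x -> exists2 e : R, 0 < e & forall y : pt R,
    `|x.1.1 - y.1.1| < e -> `|x.1.2 - y.1.2| < e -> `|x.2 - y.2| < e -> E y) ->
  drift_outer.-caratheodory E.
Proof.
move=> Eopen; have [k k1 [ [k0 ak ak'] [bk bk' Mk]]] := contraction_rate.
pose P := [set c | forall x w, coded a b x w -> drifting (phi_alpha w) ->
  cylinder c (phi_alpha w) -> E x].
pose Q := \bigcup_(c in P) cylinder c.
have QE x w : coded a b x w -> drifting (phi_alpha w) -> (Q (phi_alpha w) <-> E x).
  move=> xw dw; split=> [[c Pc wc]|Ex]; first exact: Pc xw dw wc.
  have [e e0 eE] := Eopen x Ex.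
  have [n n0 kn] : exists2 n, (0 < n)%N & k ^+ n < e.
    have /cvgrPdist_lt/(_ e e0) [n _ nP] : (fun n => k ^+ n) @ \oo --> (0 : R).
      by apply: cvg_expr; rewrite ger0_norm.
    exists n.+1 => //; have := nP n.+1 (leqnSn n).
    by rewrite sub0r normrN; apply: le_lt_trans; exact: ler_norm.
  have [m hm] := dw n.*2.
  exists (- m%:Z, mkseq (fun l => phi_alpha w (- m%:Z + l%:Z)) (m + n)); last first.
    by move=> l /=; rewrite size_mkseq => ln; rewrite nth_mkseq.
  move=> x' w' [ o' ox' co'] _ wc; have [ o ox co] := xw.
  have [] := alpha_code_contraction M_gt1 a_gt0 Ma_lt1 b_gt0 Mb_lt1 k0 ak ak' bk bk' Mk n0 co co' hm.
    by move=> l ln; rewrite (wc l) /= ?size_mkseq // nth_mkseq.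
  rewrite ox ox' => d1 d2 d3; apply: eE; apply: le_lt_trans kn => //.
apply: le_caratheodory_measurable => X.
have := caratheodory_cylinders R (card_letters_gt1 M_gt1) P (drift_codes X).
rewrite -/Q => XQ; rewrite [leRHS]XQ; apply: leeD.
  apply: (le_outer_measure outer) => t [x [Xx Ex] [w xw [tE dw]]]; rewrite tE in dw *.
  by split; [exists x => //; exists w|apply/(QE x w)].
apply: (le_outer_measure outer) => t [x [Xx nEx] [w xw [tE dw]]]; rewrite tE in dw *.
by split; [exists x => //; exists w|move=> /(QE x w xw dw)].
Qed.

Lemma caratheodory_measurable_set (E : set (mpt R)) : measurable E -> drift_outer.-caratheodory E.
Proof.
pose T := caratheodory_type drift_outer.
suff mid : measurable_fun [set: T] (fun x : T => (x : mpt R)).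
  by move=> mE; have := mid measurableT E mE; rewrite setTI.
have coordinate (f : pt R -> R) : (forall x y e, 
    `|x.1.1 - y.1.1| < e -> `|x.1.2 - y.1.2| < e -> `|x.2 - y.2| < e -> `|f x - f y| < e) ->
    measurable_fun [set: T] (f : T -> measurableTypeR R).
  move=> fP; apply: (measurability _ (measurable_realfun.RGenOInfty.measurableE R)).
  move=> _ [_ [r ->] <-]; rewrite setTI; apply: caratheodory_open => x.
  rewrite /= in_itv /= andbT => xr; exists (f x - r); first by rewrite subr_gt0.
  move=> y y1 y2 y3; have := fP _ _ _ y1 y2 y3; rewrite /= in_itv /= andbT.
  by rewrite ltr_norml => /andP[_]; rewrite ltrD2l ltrN2.
apply/prod_measurable_funP; split; last by apply: (coordinate snd) => x y e.
by apply/prod_measurable_funP; split;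
  [apply: (coordinate (fun x => x.1.1)) => x y e | apply: (coordinate (fun x => x.1.2)) => x y e].
Qed.

(** The lower bound holds for [E] and for its complement in the cube; additivity and total mass at
    most 1 leave no room for strict inequality. *)
Lemma drift_measure_leb3 (E : set (mpt R)) : measurable E -> E `<=` @cube R ->
  drift_measure E = leb3 R E.
Proof.
move=> mE Ecube; apply/eqP; rewrite eq_le leb3_le_drift_measure // andbT.
have mcube := @measurable_cube R.
have := caratheodory_measurable_set mE setT; rewrite !setTI => splitE.
have EC : (leb3 R (@cube R `\` E) <= drift_measure (~` E))%E.
  apply: le_trans (leb3_le_drift_measure _ _) _; first exact: measurableD.
    by move=> x [].
  by apply: le_drift_measure => x [].
have E1 : (leb3 R E <= 1)%E by rewrite -(@leb3_cube R); apply: le_measure; rewrite ?inE.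
have CE : (leb3 R E + leb3 R (@cube R `\` E) = 1)%E.
  rewrite -(@leb3_cube R) -measureU //; last by rewrite setDIK.
    by rewrite setDUK.
  exact: measurableD.
have : (drift_measure E + drift_measure (~` E) <= 1)%E.
  by rewrite -[X in (X <= _)%E]splitE; exact: drift_measure_le1.
move: E1 EC CE (drift_measure_le1 E) (drift_measure_le1 (~` E)) (drift_measure_ge0 E) (drift_measure_ge0 (~` E)).
move: (measure_ge0 (leb3 R) E) (measure_ge0 (leb3 R) (@cube R `\` E)).
move: (leb3 R E) (leb3 R (_ `\` _)) (drift_measure E) (drift_measure (~` E)).
move=> [x| |] // [y| |] // [z| |] // [t| |] //.
rewrite -!EFinD !lee_fin => ? ? ? ? []? ? ? ? ? ?.
lra.
Qed.

End AlphaMeasure.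

Lemma mu_alpha_Leb3 (R : realType) (M : nat) (a b : R) (E : set (pt R)) : (2 <= M)%N ->
  a = M.+1%:R^-1 -> b = (M * M.+1)%:R^-1 -> measurable E -> E `<=` @unit_cube R ->
  mu_alpha M a b E = Leb3 E.
Proof.
move=> M2 aE bE mE Ecube; have M0 : 0 < M%:R :> R by rewrite ltr0n ltnW.
have M1 : 0 < M.+1%:R :> R by rewrite ltr0n.
have a0 : 0 < a by rewrite aE invr_gt0.
have b0 : 0 < b by rewrite bE invr_gt0 ltr0n muln_gt0 ltnW.
have aM : M%:R * a = 1 - a.
  apply: (mulIf (lt0r_neq0 M1)); rewrite aE mulrBl mul1r mulVf ?lt0r_neq0 // -mulrA mulVf ?lt0r_neq0 //.
  by rewrite mulr1 -natr1 addrK.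
have bM : M%:R * b = a.
  by rewrite bE aE natrM invfM mulrA mulfV ?mul1r // lt0r_neq0.
have a1 : a < 1 by rewrite aE invf_lt1 // ltr1n ltnS ltnW.
have Ma1 : M%:R * a < 1 by rewrite aM; lra.
have Mb1 : M%:R * b < 1 by rewrite bM.
rewrite mu_alphaE // (@drift_measure_leb3 R M a b) // ?Leb3E //.
- by rewrite aM bM subrK.
- by rewrite aM opprB addrC subrK.
- by move=> x /Ecube [xu [xc xs]]; rewrite /cube /= !in_itv /= xu xc xs.
Qed.

(** * Necessity and time reversal *)

Section Necessity.
Variables (R : realType) (M : nat) (a b : R).
Hypothesis M_gt1 : (2 <= M)%N.
Hypotheses (a_gt0 : 0 < a) (Ma_lt1 : M%:R * a < 1).
Hypotheses (b_gt0 : 0 < b) (Mb_lt1 : M%:R * b < 1).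

Implicit Types (w : int -> Dsym M) (o : int -> pt R) (E : set (pt R)).

Lemma mu_alpha_le_cylinder E c :
  (forall x w, E x -> coded a b x w -> cylinder c (phi_alpha w)) ->
  (mu_alpha M a b E <= cyl_mass R c)%E.
Proof.
move=> Ec; rewrite /mu_alpha pi_imageE //; last exact: ltnW.
apply: le_trans (bernoulli_unif_cylinder R (card_letters_gt1 M_gt1) _).
by apply: le_bernoulli_unif => t [w [ [x Ex xw] _] <-]; exact: Ec xw.
Qed.

(** The codes issuing from the box lie in a one-letter cylinder, of mass [M.+1%:R^-1], so the volume
    of the box is at most that. *)
Lemma leb3_le_letter (x1 y1 x2 y2 x3 y3 : R) j s :
  (forall E : set (pt R), measurable E -> E `<=` @unit_cube R -> mu_alpha M a b E = Leb3 E) ->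
  0 <= x1 -> x1 <= y1 -> y1 <= 1 -> 0 <= x2 -> x2 <= y2 -> y2 <= 1 ->
  0 <= x3 -> x3 <= y3 -> y3 <= 1 ->
  (forall w o, box3 x1 y1 x2 y2 x3 y3 (o 0) -> coded_by a b w o -> phi_alpha w j = s) ->
  (y1 - x1) * (y2 - x2) * (y3 - x3) <= M.+1%:R^-1.
Proof.
move=> muE p1 p2 p3 q1 q2 q3 r1 r2 r3 letter.
have := @mu_alpha_le_cylinder (box3 x1 y1 x2 y2 x3 y3) (j, [:: s]).
rewrite muE; last first.
- move=> p /box3E[[u0 u1 c0] [c1 s0 s1]]; rewrite /unit_cube /=.
  by do ! split; apply/andP; split; lra.
- exact: measurable_box3.
rewrite Leb3E box3_leb3 // /cyl_mass card_letters expr1 lee_fin; apply.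
move=> x w bx [ o ox co]; apply/cylinder_cons; split; last by move=> k.
by apply: letter co; rewrite ox.
Qed.

Lemma mu_alpha_Leb3_params :
  (forall E : set (pt R), measurable E -> E `<=` @unit_cube R -> mu_alpha M a b E = Leb3 E) ->
  a = M.+1%:R^-1 /\ b = (M * M.+1)%:R^-1.
Proof.
move=> muE; have M0 : (0 < M)%N by exact: ltnW.
have Mr : 0 < M%:R :> R by rewrite ltr0n.
have M1 : 1 <= M%:R :> R by rewrite ler1n.
have [ha hb ha1 hb1] := And4 a_gt0 b_gt0 Ma_lt1 Mb_lt1.
have Mi0 : 0 < M%:R^-1 :> R by rewrite invr_gt0.
have Mi1 : M%:R^-1 <= 1 :> R by rewrite invf_le1.
have aMa : a <= M%:R * a by rewrite ler_peMl // ltW.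
have Mb0 : 0 < M%:R * b by rewrite mulr_gt0.
have iM1 : 0 < M.+1%:R :> R by rewrite ltr0n.
have nat_le0 (i : 'I_M) (h x : R) : 0 < h -> i%:R * h < x -> x < h -> i = Ordinal M0.
  move=> h0 ix xh; apply: val_inj; apply/eqP; rewrite /= -leqn0 -ltnS -(ltr_nat R).
  by rewrite -(ltr_pM2r h0) mul1r; apply: lt_trans xh.
have ge_ih (i : 'I_M) (h : R) : 0 < h -> i.+1%:R * h <= M%:R * h.
  by move=> h0; rewrite ler_pM2r // ler_nat.
(* The letter at time -1 is visible at time 0 through the image box. *)
have past w o : coded_by a b w o -> vbox b (w (-1)) (o 0).
  move=> co; have [om oE] := co (-1); rewrite addNr in oE; rewrite oE.
  exact: vbox_fpiece om.
have e1 : (a - 0) * (1 - 0) * (1 - 0) <= M.+1%:R^-1.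
  apply: (@leb3_le_letter 0 a 0 1 0 1 0 (Some (Ordinal M0)) muE) => //; try lra.
  move=> w o /box3E[[u0 u1 _] _] co; have [] := co 0; rewrite /phi_alpha.
  case: (w 0) => i /box3E[[v0 v1 _] _] _; first by rewrite (nat_le0 _ _ _ ha v0 u1).
  by exfalso; lra.
have e2 : (1 - M%:R * a) * (1 - 0) * (1 - 0) <= M.+1%:R^-1.
  apply: (@leb3_le_letter (M%:R * a) 1 0 1 0 1 0 None muE) => //; try lra.
  move=> w o /box3E[[u0 u1 _] _] co; have [] := co 0; rewrite /phi_alpha.
  case: (w 0) => i /box3E[[v0 v1 _] _] _ //.
  by have := lt_le_trans v1 (ge_ih i a ha) => h; exfalso; lra.
have e3 : (1 - 0) * (1 - 0) * (1 - (1 - M%:R * b)) <= M.+1%:R^-1.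
  apply: (@leb3_le_letter 0 1 0 1 (1 - M%:R * b) 1 (-1) None muE) => //; try lra.
  move=> w o /box3E[_ [_ s0 s1]] /past; rewrite /phi_alpha.
  case: (w (-1)) => i /box3E[_ [_ t0 t1]] //.
  by exfalso; lra.
have e4 : (1 - 0) * (M%:R^-1 - 0) * (1 - M%:R * b - 0) <= M.+1%:R^-1.
  apply: (@leb3_le_letter 0 1 0 (M%:R^-1) 0 (1 - M%:R * b) (-1) (Some (Ordinal M0)) muE) => //; try lra.
  move=> w o /box3E[[_ _ _] [c1 s0 s1]] /past; rewrite /phi_alpha.
  case: (w (-1)) => i /box3E[[_ _ d0] [_ t0 t1]]; first by rewrite (nat_le0 _ _ _ Mi0 d0 c1).
  have : 0 <= i%:R * b by rewrite mulr_ge0 // ltW.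
  by move=> h; exfalso; lra.
rewrite !subr0 !mulr1 ?mul1r in e1 e2 e3 e4.
(* With [q] for [M.+1%:R^-1], the bounds read [a <= q], [1 - M a <= q], [M b <= q] and
   [1 - M b <= M q]. Since [M q + q = 1], they force [a = q] and [M b = q]. *)
have N1 : M%:R * M.+1%:R^-1 + M.+1%:R^-1 = 1 :> R.
  by rewrite -[X in _ + X]mul1r -mulrDl natr1 mulfV // lt0r_neq0.
rewrite mulrC ler_pdivrMr // mulrC in e4; rewrite natrM invfM -[b](mulKf (lt0r_neq0 Mr)).
move: (M.+1%:R^-1) N1 e1 e2 e3 e4 => q N1 e1 e2 e3 e4; split.
  apply/eqP; rewrite eq_le e1 /= -(ler_pM2l Mr); lra.
congr (_ * _); apply/eqP; rewrite eq_le; apply/andP; split; lra.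
Qed.
End Necessity.

(** * Time reversal of codes and orbits *)

Definition flip M (g : Dsym M) : Dsym M :=
  match g with Alpha i => Beta (rev_ord i) | Beta i => Alpha (rev_ord i) end.

(** The letter at [n] belongs to the step from [n] to [n + 1], which reversed time runs from
    [-1 - n] to [- n]. [flip] reverses indices because the reflection reverses the order of the
    slots. *)
Definition reverse M (w : int -> Dsym M) (n : int) : Dsym M := flip (w (-1 - n)).

Definition reverse_code M (t : int -> option 'I_M) (n : int) : option 'I_M :=
  omap (@rev_ord M) (t (-1 - n)).

Lemma phi_alpha_reverse M (w : int -> Dsym M) : phi_alpha (reverse w) = reverse_code (phi_beta w).
Proof. by apply/funext => n; rewrite /reverse_code /phi_alpha /phi_beta /reverse; case: (w _). Qed.

Lemma phi_beta_reverse M (w : int -> Dsym M) : phi_beta (reverse w) = reverse_code (phi_alpha w).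
Proof. by apply/funext => n; rewrite /reverse_code /phi_alpha /phi_beta /reverse; case: (w _). Qed.

Lemma H_reverse M (w : int -> Dsym M) n : H (reverse w) n = H w (- n).
Proof.
have sgn_flip g : sgn (flip g) = - sgn g :> int by case: g.
have H0 (v : int -> Dsym M) : H v 0 = 0 by rewrite /H /= big_geq.
have step m : H (reverse w) (m + 1) - H w (- (m + 1)) = H (reverse w) m - H w (- m).
  have := HS w (-1 - m); rewrite (HS (reverse w)) {2}/reverse sgn_flip.
  have -> : -1 - m + 1 = - m by lia.
  have -> : - (m + 1) = -1 - m by lia.
  by move=> ->; lia.
suff : H (reverse w) n - H w (- n) = 0 by lia.
case: n => n.
  elim: n => [|n IH]; first by rewrite oppr0 !H0.
  by rewrite -addn1 PoszD step.
elim: n => [|n IH].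
  by have := step (-1); rewrite addNr oppr0 !H0 => <-; rewrite subrr.
have := step (Negz n.+1); have -> : Negz n.+1 + 1 = Negz n by rewrite !NegzE; lia.
by rewrite IH.
Qed.

Lemma bernoulli_unif_reverse (R : realType) M (S : set (int -> option 'I_M)) : (2 <= M)%N ->
  (bernoulli_unif R (@reverse_code M @^-1` S) <= bernoulli_unif R S)%E.
Proof.
move=> M2; apply: le_ereal_inf_tmp => _ [c Sc <-].
(* A word on the positions from [j] to [j + size - 1] becomes a word of the same length on those
   from [- (j + size)] to [- j - 1]. *)
pose c' k := (- ((c k).1 + (size (c k).2)%:Z), rev (map (omap (@rev_ord M)) (c k).2)).
have -> : (\sum_(0 <= k <oo) cyl_mass R (c k) = \sum_(0 <= k <oo) cyl_mass R (c' k))%E.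
  by apply: eq_eseriesr => k _; rewrite /cyl_mass /c' /= size_rev size_map.
apply: ereal_inf_lbound; exists c' => // t /Sc[k _ tk]; exists k => // l.
rewrite /c' /= size_rev size_map; move szE : (size (c k).2) => sz ln.
have ls : (sz - l.+1 < sz)%N by move: ln; clear; lia.
rewrite nth_rev ?size_map szE // (nth_map (reverse_code t 0)) ?szE //.
have := tk (sz - l.+1)%N; rewrite szE => /(_ ls) <-.
rewrite /reverse_code.
have -> : -1 - ((c k).1 + (sz - l.+1)%N%:Z) = - ((c k).1 + sz%:Z) + l%:Z.
  by move: ln; move: ((c k).1) => j; clear; lia.
by case: (t _) => //= i; rewrite rev_ordK.
Qed.

Section Reversal.
Variables (R : realType) (M : nat) (a b : R).
Hypothesis M_gt1 : (2 <= M)%N.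
Hypotheses (a_gt0 : 0 < a) (Ma_lt1 : M%:R * a < 1).
Hypotheses (b_gt0 : 0 < b) (Mb_lt1 : M%:R * b < 1).

Lemma reflectionK : involutive (@reflection R).
Proof. by move=> [[u c] s]; rewrite /reflection /=; congr ((_, _), _); ring. Qed.

Lemma rev_ord_natr (i : 'I_M) : (rev_ord i)%:R = M%:R - i%:R - 1 :> R.
Proof. by rewrite /= natrB // -natr1 opprD addrA. Qed.

Lemma obox_reflection (g : Dsym M) p : vbox b g p -> obox b (flip g) (reflection p).
Proof.
have Mr : 0 < M%:R :> R by rewrite ltr0n ltnW.
have MM : M%:R / M%:R = 1 :> R by rewrite divff // lt0r_neq0.
case: g => i /box3E[[u0 u1 c0] [c1 s0 s1]]; apply/box3E; rewrite -natr1 rev_ord_natr.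
  rewrite -natr1 mulrDl in c1; rewrite mulrDl !mulrBl MM /=.
  by do ! split; lra.
rewrite -natr1 mulrDl in s1; rewrite mulrDl !mulrBl /=.
by do ! split; lra.
Qed.

Lemma fpiece_reflection (g : Dsym M) p :
  fpiece b a (flip g) (reflection (fpiece a b g p)) = reflection p.
Proof.
have Mr : 0 < M%:R :> R by rewrite ltr0n ltnW.
have sa : 0 < 1 - M%:R * a by rewrite subr_gt0.
have sb : 0 < 1 - M%:R * b by rewrite subr_gt0.
case: g => i; case: p => -[u c] s; rewrite /reflection /= -?[(rev_ord i).+1%:R]natr1 ?rev_ord_natr -?natr1.
  by congr ((_, _), _); rewrite ?rev_ord_natr; field; rewrite ?lt0r_neq0.
by congr ((_, _), _); rewrite ?rev_ord_natr; field; rewrite ?lt0r_neq0.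
Qed.

Lemma coded_reflection x (w : int -> Dsym M) :
  coded a b x w -> coded b a (reflection x) (reverse w).
Proof.
move=> [ o ox co]; exists (fun n => reflection (o (- n))); first by rewrite oppr0 ox.
move=> n; have [on oE] := co (-1 - n).
rewrite /reverse (_ : -1 - n + 1 = - n) in oE; last by lia.
rewrite oE; split.
  by apply: obox_reflection; exact: (vbox_fpiece (ltnW M_gt1) a_gt0 Ma_lt1 b_gt0 Mb_lt1 on).
by rewrite fpiece_reflection (_ : - (n + 1) = -1 - n) //; lia.
Qed.

End Reversal.

(** Reversal exchanges [B_alpha] and [B_beta] with the same offset [j], as [H] is reflected in time.
    It is used once in each direction, each use giving one inequality. *)
Lemma mu_beta_reflection (R : realType) (M : nat) (a b : R) E : (2 <= M)%N ->
  0 < a -> M%:R * a < 1 -> 0 < b -> M%:R * b < 1 ->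
  mu_beta M a b E = mu_alpha M b a (@reflection R @^-1` E).
Proof.
move=> M2 a0 a1 b0 b1; have M0 : (0 < M)%N by exact: ltnW.
rewrite /mu_beta /mu_alpha !pi_imageE //.
apply/eqP; rewrite eq_le; apply/andP; split.
  apply: le_trans (bernoulli_unif_reverse R _ M2); apply: le_bernoulli_unif.
  move=> t [w [ [x Ex xw] [_ wB]] <-]; exists (reverse w); last exact: phi_alpha_reverse.
  have rw := coded_reflection M2 a0 a1 b0 b1 xw.
  split; first by exists (reflection x) => //=; rewrite reflectionK.
  split; first exact: coded_Sigma_D rw.
  move=> i; case: (boolP (isAlpha (reverse w i))) => wi; [by left|right; split=> //].
  have [|[_ [j [j1 jH]]]] := wB (-1 - i).
    by move: wi; rewrite /reverse; case: (w _).
  by exists j; split=> //; rewrite !H_reverse; move: jH; congr (H w _ = H w _); lia.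
apply: le_trans (bernoulli_unif_reverse R _ M2); apply: le_bernoulli_unif.
move=> t [w [ [x Ex xw] [_ wB]] <-]; exists (reverse w); last exact: phi_beta_reverse.
have rw := coded_reflection M2 b0 b1 a0 a1 xw.
split; first by exists (reflection x).
split; first exact: coded_Sigma_D rw.
move=> i; case: (boolP (isAlpha (reverse w i))) => wi; [right; split=> //|by left].
have [|[_ [j [j1 jH]]]] := wB (-1 - i).
  by move: wi; rewrite /reverse; case: (w _).
by exists j; split=> //; rewrite !H_reverse; move: jH; congr (H w _ = H w _); lia.
Qed.

Lemma reflection_unit_cube (R : realType) (E : set (pt R)) :
  E `<=` @unit_cube R -> @reflection R @^-1` E `<=` @unit_cube R.
Proof.
move=> Ecube p /Ecube [/andP[u0 u1] [/andP[c0 c1] /andP[s0 s1]]].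
rewrite /= in u0 u1 c0 c1 s0 s1.
by do ! split; apply/andP; split; lra.
Qed.

Lemma measurable_reflection_preimage (R : realType) (E : set (mpt R)) :
  measurable E -> measurable (@reflection R @^-1` E).
Proof. by move=> mE; rewrite -[X in measurable X]setTI; exact: measurable_reflection. Qed.

Unset Implicit Arguments.
Set Strict Implicit.

Theorem mainTheorem4 (R : realType) (M : nat) (a b : R) :
  (2 <= M)%N ->
  0 < a < M%:R^-1 -> 0 < b < M%:R^-1 ->
  ((forall E : set (pt R), measurable E -> E `<=` @unit_cube R ->
      mu_alpha M a b E = Leb3 E)
     <-> (a = (M.+1)%:R^-1 /\ b = (M * M.+1)%:R^-1))
  /\
  ((forall E : set (pt R), measurable E -> E `<=` @unit_cube R ->
      mu_beta M a b E = Leb3 E)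
     <-> (a = (M * M.+1)%:R^-1 /\ b = (M.+1)%:R^-1)).
Proof.
move=> M2 /andP[a0 aM] /andP[b0 bM].
have Mr : 0 < M%:R :> R by rewrite ltr0n ltnW.
have lt1 x : x < M%:R^-1 -> M%:R * x < 1 :> R by rewrite -(ltr_pM2l Mr) mulfV // lt0r_neq0.
have [a1 b1] := (lt1 _ aM, lt1 _ bM).
split; split.
- exact: mu_alpha_Leb3_params.
- by move=> [aE bE] E mE; exact: mu_alpha_Leb3.
- move=> muE; suff [-> ->] : b = M.+1%:R^-1 /\ a = (M * M.+1)%:R^-1 by [].
  apply: mu_alpha_Leb3_params => // E mE Ecube.
  (* The reflection is an involution, so every [E] is a preimage and part (i) with [a] and [b]
     exchanged applies. *)
  have rE : E = @reflection R @^-1` (@reflection R @^-1` E).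
    by apply/seteqP; split => x /=; rewrite reflectionK.
  rewrite {1}rE -mu_beta_reflection // muE; last exact: reflection_unit_cube.
    by rewrite Leb3E leb3_reflection.
  exact: measurable_reflection_preimage.
- move=> [aE bE] E mE Ecube; rewrite mu_beta_reflection // (mu_alpha_Leb3 M2 bE aE).
  + by rewrite Leb3E leb3_reflection.
  + exact: measurable_reflection_preimage.
  + exact: reflection_unit_cube.
Qed.
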